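(* Let $C$ be a connected Cartan matrix which is either of Dynkin type, or of Euclidean type belonging to one of the seven infinite series $\tilde A_m,\tilde B_m,\tilde C_m,\widetilde{BC}_m,\widetilde{BD}_m,\widetilde{CD}_m,\tilde D_m$ (i.e. not one of the exceptional Euclidean types). Then for every acyclic orientation of the simple graph of $C$, each sequence $(a(j,n))_{n\in\mathbf N}$ of the associated frise is $\mathbf N$-rational; in particular it satisfies a linear recurrence.
   Context: A Cartan matrix is a $d\times d$ integer matrix $C$ with $C_{ii}=2$, $C_{ij}\le 0$ for $i\ne j$, and $C_{ij}\neq0\iff C_{ji}\ne 0$; its simple graph has vertices $1,\dots,d$ and an edge $\{i,j\}$ whenever $i\ne j$, $C_{ij}\ne 0$. Given an acyclic orientation (write $i\to j$), the frise consists of the sequences defined by $a(j,0)=1$ and $a(j,n)a(j,n+1)=1+\big(\prod_{j\to i}a(i,n)^{|C_{ij}|}\big)\big(\prod_{i\to j}a(i,n+1)^{|C_{ij}|}\big)$. A sequence $(a_n)_{n\in\mathbf N}$ of natural numbers is $\mathbf N$-rational if there exist $r\ge1$, $\lambda\in\mathbf N^{1\times r}$, $M\in\mathbf N^{r\times r}$, $\gamma\in\mathbf N^{r\times 1}$ with $a_n=\lambda M^n\gamma$ for all $n\in\mathbf N$. The Euclidean series are named as in the Dlab–Ringel classification of affine valued diagrams; the excluded exceptional Euclidean diagrams are the finitely many ones not in these seven series (e.g. $\tilde E_6,\tilde E_7,\tilde E_8$, $\tilde F_4$-, $\tilde G_2$-types). *)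

(* Defs.v *)
From HB Require Import structures.
From mathcomp Require Import all_boot all_order all_algebra.
From mathcomp Require Import fingroup perm.
Set Implicit Arguments.
Unset Strict Implicit.
Unset Printing Implicit Defensive.
Import Order.TTheory GRing.Theory Num.Theory.
Local Open Scope ring_scope.

Definition is_cartan (d : nat) (C : 'M[int]_d) : Prop :=
  [/\ forall i, C i i = 2,
      forall i j, i != j -> C i j <= 0
    & forall i j, (C i j != 0) = (C j i != 0)].

Definition cedge (d : nat) (C : 'M[int]_d) : rel 'I_d :=
  fun i j => (i != j) && (C i j != 0).

Definition cartan_connected (d : nat) (C : 'M[int]_d) : Prop :=
  forall i j : 'I_d, connect (cedge C) i j.

(* o i j means the edge {i,j} is oriented i -> j *)
Definition acyclic_orientation (d : nat) (C : 'M[int]_d) (o : rel 'I_d) : Prop :=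
  [/\ forall i j, o i j -> cedge C i j,
      forall i j, cedge C i j -> o i j || o j i,
      forall i j, o i j -> ~~ o j i
    & forall i j, o i j -> ~~ connect o j i].

Definition is_frise (d : nat) (C : 'M[int]_d) (o : rel 'I_d)
    (a : 'I_d -> nat -> rat) : Prop :=
  (forall j, a j 0%N = 1) /\
  (forall j n, a j n * a j n.+1 =
     1 + (\prod_(i | o j i) a i n ^+ `|C i j|%N)
         * (\prod_(i | o i j) a i n.+1 ^+ `|C i j|%N)).

Definition N_rational (u : nat -> rat) : Prop :=
  exists (r : nat) (lam : 'M[nat]_(1, r.+1)) (M : 'M[nat]_r.+1)
         (gam : 'M[nat]_(r.+1, 1)),
    forall n, u n = ((lam *m (M ^+ n) *m gam) 0 0)%:R.

(* A list of bonds (a, b, (c_ab, c_ba)) defines a matrix on nat indices. *)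
Definition gcm (E : seq (nat * nat * (int * int))) (i j : nat) : int :=
  if i == j then 2 else
  \sum_(e <- E) ((if (e.1.1 == i) && (e.1.2 == j) then e.2.1 else 0)
               + (if (e.1.1 == j) && (e.1.2 == i) then e.2.2 else 0)).

Definition sbond (a b : nat) : nat * nat * (int * int) := (a, b, (-1, -1)%R).

Definition chain (m len : nat) := [seq sbond k k.+1 | k <- iota m len].

Definition dbl (b : bool) : int * int := if b then (-2, -1) else (-1, -2).

Definition typeA (d : nat) := gcm (chain 0 d.-1).
Definition typeBC (b : bool) (d : nat) :=
  gcm (rcons (chain 0 (d - 2)) ((d - 2)%N, d.-1, dbl b)).
Definition typeD (d : nat) :=
  gcm (rcons (chain 0 (d - 2)) (sbond (d - 3)%N d.-1)).
Definition typeE (d : nat) :=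
  gcm (rcons (chain 0 (d - 2)) (sbond 2 d.-1)).
Definition typeF4 := gcm [:: sbond 0 1; (1%N, 2%N, (-2, -1)); sbond 2 3].
Definition typeG2 := gcm [:: (0%N, 1%N, (-3, -1))].

(* Euclidean types of the seven infinite series (Kac: A_n^(1), B_n^(1),
   C_n^(1), D_n^(1), A_{2n-1}^(2), A_{2n}^(2), D_{n+1}^(2)), d = n+1 *)
Definition affA11 := gcm [:: (0%N, 1%N, (-2, -2))].
Definition affA22 := gcm [:: (0%N, 1%N, (-4, -1))].
Definition affCycle (d : nat) :=                           (* A_n^(1), d >= 3 *)
  gcm (rcons (chain 0 d.-1) (sbond d.-1 0)).
(* double bonds at both ends of a chain, d >= 3: C_n^(1), D_{n+1}^(2),
   A_{2n}^(2) (n >= 2) *)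
Definition affDoubleDouble (p q : bool) (d : nat) :=
  gcm ((0%N, 1%N, dbl p) :: rcons (chain 1 (d - 3)) ((d - 2)%N, d.-1, dbl q)).
(* fork at one end, double bond at the other, d >= 4: B_n^(1), A_{2n-1}^(2) *)
Definition affForkDouble (q : bool) (d : nat) :=
  gcm (sbond 0 2 :: rcons (chain 1 (d - 3)) ((d - 2)%N, d.-1, dbl q)).
(* forks at both ends, d >= 5: D_n^(1) (n >= 4) *)
Definition affD (d : nat) :=
  gcm (sbond 0 2 :: rcons (chain 1 (d - 3)) (sbond (d - 3)%N d.-1)).

Definition cartan_of_type (d : nat) (C : 'M[int]_d) (T : nat -> nat -> int) : Prop :=
  exists s : 'S_d, forall i j : 'I_d, C i j = T (s i) (s j).

Definition dynkin_type (d : nat) (C : 'M[int]_d) : Prop :=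
     ((1 <= d)%N /\ cartan_of_type C (typeA d))
  \/ ((2 <= d)%N /\ (exists b, cartan_of_type C (typeBC b d)))
  \/ ((4 <= d)%N /\ cartan_of_type C (typeD d))
  \/ ((d \in [:: 6; 7; 8]%N) /\ cartan_of_type C (typeE d))
  \/ (d = 4%N /\ cartan_of_type C typeF4)
  \/ (d = 2%N /\ cartan_of_type C typeG2).

Definition euclidean_series_type (d : nat) (C : 'M[int]_d) : Prop :=
     (d = 2%N /\ (cartan_of_type C affA11 \/ cartan_of_type C affA22))
  \/ ((3 <= d)%N /\ cartan_of_type C (affCycle d))
  \/ ((3 <= d)%N /\ (exists p q, cartan_of_type C (affDoubleDouble p q d)))
  \/ ((4 <= d)%N /\ (exists q, cartan_of_type C (affForkDouble q d)))
  \/ ((5 <= d)%N /\ cartan_of_type C (affD d)).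

(* Main.v *)
Require Import Defs.
From HB Require Import structures.
From mathcomp Require Import all_boot all_order all_algebra.
From mathcomp Require Import fingroup perm.
From mathcomp Require Import ring zify.
From Stdlib Require BinNat Nnat.
Import Order.TTheory GRing.Theory Num.Theory.
Local Open Scope ring_scope.

(* The recursion determines the frise, so it is enough to exhibit a solution. On a chain the
   relation says that neighbouring 2x2 minors of a tiling of the plane are 1, hence the entries are
   determinants det(v_i, w_j) of two sequences of vectors with det(v_i, v_(i+1)) = 1. The initial
   path of 1s is realised by Farey vectors (a, b): a step of the orientation replaces a by a + b or
   b by a + b. The ends of the chain glue the two sequences by matrices of determinant 1: -1 and 1 at
   a free end, and a parabolic matrix at a fork, whose arms are the linear forms with square equal to
   the corresponding quadratic form. A cycle imposes v_(i+s) = G v_i, w_(j-r) = G w_j instead, with G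
   the product of all steps. A chain with a free end gives periodic sequences. For two forks and for
   cycles the vectors eventually evolve under a matrix with entries in N, and the entries of the
   frise are bilinear forms over N in them. Double bonds fold forks and chains with a reflection,
   so they reduce to these cases. For E, F and G periodicity is checked on all orientations. *)

(** * Closure properties of N-rational sequences *)

(** Two obstacles shape the proof: the recursion divides, and a determinant subtracts. The division
    is harmless. Determinants of integer vectors are integers, and positivity can be read off the
    recursion, so the entries are natural without tracking any sign in the closed formula. The
    subtraction is what stands against coefficients in N: [u1 w2 - u2 w1] is a form over N only if
    [u] stays in the first quadrant and [w] in the second. The Farey vectors of the initial path all
    have nonnegative coordinates, so this fails at first; it holds once the second vector has passed
    through a gluing, or once around the cycle. Hence the entries are shifted by about one turn, and
    the finitely many earlier values are put back as a prefix. At a fork [A * B = 4] gives trace 2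
    or -2, the borderline between finite order and exponential growth. A free end contributes plus
    or minus the identity, so that one turn is undone in every determinant: this is why the Dynkin
    chains are periodic whatever stands at their other end. *)

Definition linrec (u : nat -> rat) : Prop :=
  exists (I : finType) (A : I -> I -> nat) (f : I -> nat -> nat) (l : I -> nat),
    (forall i n, f i n.+1 = \sum_j A i j * f j n)%N
    /\ forall n, u n = ((\sum_i l i * f i n)%N)%:R.

Lemma eq_linrec u w : u =1 w -> linrec u -> linrec w.
Proof. by move=> e [I [A [f [l [H1 H2]]]]]; exists I, A, f, l; split=> // n; rewrite -e. Qed.

(** In [linrec] the states form any finite type, so that sums and products of sequences become
    disjoint unions and products of state sets; states are numbered only here. *)
Lemma linrec_N_rational u : linrec u -> N_rational u.
Proof.
move=> [I [A [f [l [Hf Hu]]]]].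
(* The index [ord0] is a dummy zero state: [N_rational] asks for a positive size, while [I] may be
   empty. *)
pose ix (i : 'I_(#|I|.+1)) := omap (@enum_val I (mem I)) (unlift ord0 i).
pose fx (i : 'I_(#|I|.+1)) n := if ix i is Some x then f x n else 0%N.
have sumE (F : I -> nat) : (\sum_(i < #|I|.+1) (if ix i is Some x then F x else 0) = \sum_x F x)%N.
  rewrite big_ord_recl /= /ix unlift_none /= add0n.
  under eq_bigr do rewrite liftK /=.
  by rewrite (reindex_onto enum_rank enum_val) /=; [apply: eq_big => i; rewrite ?enum_rankK ?eqxx | move=> i _; rewrite enum_valK].
pose M : 'M[nat]_(#|I|.+1) :=
  \matrix_(i, j) if ix i is Some x then if ix j is Some y then A x y else 0%N else 0%N.
exists #|I|, (\row_i (if ix i is Some x then l x else 0%N)),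
M, (\col_i fx i 0%N) => n.
have HM : M ^+ n *m (\col_i fx i 0%N) = \col_i fx i n.
  elim: n => [|n IH]; first by rewrite expr0 mul1mx.
  rewrite exprS -mulmxA IH; apply/matrixP => i j; rewrite !mxE /fx.
  case Ei: (ix i) => [x|]; last by rewrite big1 // => k _; rewrite !mxE Ei mul0r.
  rewrite Hf -(sumE (fun y => A x y * f y n)%N).
  by apply: eq_bigr => k _; rewrite !mxE Ei; case: (ix k).
rewrite Hu -mulmxA HM !mxE; congr (_%:R).
rewrite -(sumE (fun x => l x * f x n)%N); apply: eq_bigr => k _.
by rewrite !mxE /fx; case: (ix k).
Qed.

Lemma linrec_const k : linrec (fun=> k%:R).
Proof.
exists 'I_1, (fun _ _ => 1%N), (fun _ _ => k), (fun=> 1%N); split=> [i n|n].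
  by rewrite big_ord1 mul1n.
by rewrite big_ord1 mul1n.
Qed.

Lemma linrec_shift u p : linrec u -> linrec (fun n => u (n + p)%N).
Proof.
by move=> [I [A [f [l [Hf Hu]]]]]; exists I, A, (fun i n => f i (n + p)%N), l; split=> [i n|n]; rewrite ?addSn.
Qed.

Lemma linrecD u w : linrec u -> linrec w -> linrec (fun n => u n + w n).
Proof.
move=> [I [A [f [l [Hf Hu]]]]] [J [B [g [k [Hg Hw]]]]].
exists (I + J)%type,
  (fun a b => match a, b with inl i, inl i' => A i i' | inr j, inr j' => B j j' | _, _ => 0%N end),
  (fun a n => match a with inl i => f i n | inr j => g j n end),
  (fun a => match a with inl i => l i | inr j => k j end); split=> [a n|n].
  rewrite big_sumType; case: a => [i|j] /=.
    by rewrite [X in (_ + X)%N]big1 // addn0.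
  by rewrite [X in (X + _)%N]big1 // add0n.
by rewrite Hu Hw -natrD big_sumType.
Qed.

Lemma linrecM u w : linrec u -> linrec w -> linrec (fun n => u n * w n).
Proof.
move=> [I [A [f [l [Hf Hu]]]]] [J [B [g [k [Hg Hw]]]]].
have E (a : I -> nat) (b : I -> nat) (c : J -> nat) (d : J -> nat) :
    ((\sum_i a i * b i) * (\sum_j c j * d j) = \sum_(p : I * J) (a p.1 * c p.2) * (b p.1 * d p.2))%N.
  rewrite big_distrl /= -(pair_big xpredT xpredT (fun i j => a i * c j * (b i * d j))%N) /=.
  by apply: eq_bigr => i _; rewrite big_distrr /=; apply: eq_bigr => j _; rewrite mulnACA.
exists (I * J)%type, (fun a b => A a.1 b.1 * B a.2 b.2)%N, (fun a n => f a.1 n * g a.2 n)%N,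
  (fun a => l a.1 * k a.2)%N; split=> [a n|n]; first by rewrite Hf Hg E.
by rewrite Hu Hw -natrM E.
Qed.

Lemma linrecZ k u : k \is a Num.nat -> linrec u -> linrec (fun n => k * u n).
Proof. by move=> /natrP[c ->] Hu; apply: linrecM => //; apply: linrec_const. Qed.

(** A new state, equal to 1 at time 0 only, emits [u 0] and starts the old states one step later. *)
Lemma linrec_cons u : u 0%N \is a Num.nat -> linrec (fun n => u n.+1) -> linrec u.
Proof.
move=> /natrP[c Hc] [I [A [f [l [Hf Hu]]]]].
exists ('I_1 + I)%type,
  (fun a b => match a, b with inr i, inr j => A i j | inr i, inl _ => f i 0%N | _, _ => 0%N end),
  (fun a n => match a with inr i => if n is n'.+1 then f i n' else 0%N | inl _ => (n == 0)%N : nat end),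
  (fun a => match a with inr i => l i | inl _ => c end); split=> [a n|n].
  rewrite big_sumType big_ord1 /=; case: a => [i|i] /=; first by rewrite big1.
  case: n => [|n]; first by rewrite big1 ?addn0 ?muln1 // => j _; rewrite muln0.
  by rewrite muln0 add0n Hf.
rewrite big_sumType big_ord1 /=; case: n => [|n].
  by rewrite big1 => [|j _]; rewrite ?muln0 // addn0 muln1.
by rewrite muln0 add0n Hu.
Qed.

Lemma linrec_prefix p u : (forall n, (n < p)%N -> u n \is a Num.nat) ->
  linrec (fun n => u (n + p)%N) -> linrec u.
Proof.
elim: p u => [|p IH] u Hn Hu; first by apply: eq_linrec Hu => n; rewrite addn0.
apply: linrec_cons; first exact: Hn.
apply: IH => [n lt|]; first exact: Hn.
by apply: eq_linrec Hu => n; rewrite addnS.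
Qed.

(** The states are sliding windows: [(i, k)] holds [f i (n + k)] for [k < L]. All but the last slot
    shift; the last one uses the recurrence. *)
Lemma linrec_delay (I : finType) (L : nat) (f : I -> nat -> rat) (A : I -> I -> rat) :
  (0 < L)%N -> (forall i j, A i j \is a Num.nat) ->
  (forall i n, (n < L)%N -> f i n \is a Num.nat) ->
  (forall i n, f i (n + L)%N = \sum_j A i j * f j n) ->
  forall i, linrec (f i).
Proof.
move=> L0 HA H0 HL i0.
have Hnat i n : f i n \is a Num.nat.
  elim/ltn_ind: n i => n IH i; case: (ltnP n L) => [|le]; first exact: H0.
  rewrite -(subnK le) HL; apply: rpred_sum => j _; apply: rpredM => //.
  by apply: IH; rewrite ltn_subrL L0 (leq_trans L0 le).
pose fN i n := Num.truncn (f i n); pose AN i j := Num.truncn (A i j).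
have fE i n : f i n = (fN i n)%:R by rewrite /fN truncnK.
have AE i j : A i j = (AN i j)%:R by rewrite /AN truncnK.
case: L L0 H0 HL => // L _ H0 HL.
have HLN i n : fN i (n + L.+1)%N = (\sum_j AN i j * fN j n)%N.
  apply/eqP; rewrite -(eqr_nat rat) -fE HL natr_sum; apply/eqP.
  by apply: eq_bigr => j _; rewrite AE fE natrM.
exists (I * 'I_L.+1)%type,
  (fun a b : I * 'I_L.+1 => if (a.2 < L)%N then ((b.1 == a.1) && (b.2 == a.2.+1 :> nat)) : nat
              else if b.2 == ord0 then AN a.1 b.1 else 0%N),
  (fun (a : I * 'I_L.+1) n => fN a.1 (n + a.2)%N), (fun a : I * 'I_L.+1 => a == (i0, ord0) : nat); split=> [[i k] n|n] /=.
  rewrite addSn -addnS; case: ltnP => [lt|le].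
    rewrite (bigD1 (i, Ordinal (lt : (k.+1 < L.+1)%N))) //= !eqxx mul1n big1 ?addn0 // => [[j l]] /=.
    rewrite xpair_eqE -(inj_eq val_inj) /=; case: andP => // [[/eqP-> /eqP->]]; by rewrite !eqxx.
  have -> : k = L :> nat by apply/eqP; rewrite eqn_leq le -ltnS ltn_ord.
  rewrite HLN -(pair_big xpredT xpredT (fun j (l : 'I_L.+1) => (if l == ord0 then AN i j else 0) * fN j (n + l))%N) /=.
  apply: eq_bigr => j _; rewrite big_ord_recl /= addn0 big1 ?addn0 //.
rewrite (bigD1 (i0, ord0)) //= eqxx mul1n addn0 big1 ?addn0 // => j /negbTE->; by rewrite mul0n.
Qed.

Lemma linrec_periodic L (u : nat -> rat) : (0 < L)%N -> (forall n, u n \is a Num.nat) ->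
  (forall n, u (n + L)%N = u n) -> linrec u.
Proof.
move=> L0 Hn HL; apply: (@linrec_delay 'I_1 L (fun _ => u) (fun _ _ => 1)) => // [_ n|]; last exact: ord0.
by rewrite big_ord1 mul1r.
Qed.

(** * Frises on a chain *)

(* The chain has vertices 0..m, [eps k] means k -> k.+1, and [lv], [rv] are the factors
   contributed to the relations at 0 and m from beyond the ends. *)
Definition strip (m : nat) (eps : nat -> bool) (f : nat -> nat -> rat)
    (lv rv : nat -> rat) : Prop :=
  (forall k, (k <= m)%N -> f k 0%N = 1) /\
  (forall k n, (k <= m)%N -> f k n * f k n.+1 =
     1 + (if k is k'.+1 then f k' (n + eps k')%N else lv n)
         * (if (k < m)%N then f k.+1 (n + ~~ eps k)%N else rv n)).

(* A vertex attached to one with values g; o is true when the arrow leaves the arm. *)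
Definition arm (g : nat -> rat) (o : bool) (x : nat -> rat) : Prop :=
  x 0%N = 1 /\ forall n, x n * x n.+1 = 1 + g (n + ~~ o)%N.

Definition fork (g lv : nat -> rat) (o1 o2 : bool) (x1 x2 : nat -> rat) : Prop :=
  [/\ arm g o1 x1, arm g o2 x2 & forall n, lv n = x1 (n + o1)%N * x2 (n + o2)%N].

Lemma strip_rev m eps f lv rv : strip m eps f lv rv ->
  strip m (fun k => ~~ eps (m - k.+1)%N) (fun k => f (m - k)%N) rv lv.
Proof.
move=> [H0 Hf]; split=> [k le|k n le]; first by rewrite H0 ?leq_subr.
rewrite Hf ?leq_subr // mulrC; congr (_ + _ * _).
  case: k le => [|k] le; first by rewrite subn0 ltnn.
  by rewrite ltn_subrL (leq_trans _ le) //= subnSK.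
case: ltnP => lt; last by rewrite (_ : m - k = 0)%N //; apply/eqP; rewrite subn_eq0.
by rewrite -subnSK // negbK.
Qed.

Definition mirror (m k : nat) := if (k <= m)%N then k else (m.*2 - k)%N.

(** The vertex [m] sees its neighbour twice. The mirror image of the chain supplies the second copy,
    and [m] becomes an interior vertex. *)
Lemma strip_unfold m eps f lv rv : (0 < m)%N -> strip m eps f lv rv ->
  (forall n, rv n = f m.-1 (n + eps m.-1)%N) ->
  strip m.*2 (fun k => if (k < m)%N then eps k else ~~ eps (m.*2 - k.+1)%N)
    (fun k => f (mirror m k)) lv lv.
Proof.
move=> m0 [H0 Hf] Hrv; rewrite /mirror; split=> [k le|k n le].
  by rewrite H0 //; case: (leqP k m) => //; lia.
case: (leqP k m) => km.
  rewrite Hf //; congr (_ + _ * _).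
    by case: k km le => [|k] km le //; rewrite (ltnW km) km.
  case: (ltnP k m) => lt.
    by have -> : (k < m.*2)%N by lia.
  have -> : k = m by lia.
  have -> : (m < m.*2)%N by lia.
  rewrite Hrv negbK; have -> : (m.*2 - m.+1 = m.-1)%N by lia.
  by [].
have kE : k = k.-1.+1 by lia.
rewrite Hf; last by lia.
rewrite mulrC kE; congr (_ + _ * _).
  have -> : (m.*2 - k.-1.+1 < m)%N by lia.
  have -> : (k.-1 < m)%N = false by lia.
  case: leqP => le'.
    have -> : k.-1 = m by lia.
    by congr (f _ _); lia.
  by congr (f _ _); lia.
case: ltnP => lt.
  have -> : (k.-1.+1 < m)%N = false by lia.
  have -> : (m.*2 - k.-1.+1 = (m.*2 - k.-1.+2).+1)%N by lia.
  by rewrite negbK.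
by have -> : (m.*2 - k.-1.+1 = 0)%N by lia.
Qed.

(* A constant boundary value 1 is a further vertex beyond which the value is 0. *)
Lemma strip_extend m eps f lv rv : strip m eps f lv rv -> (forall n, lv n = 1) ->
  strip m.+1 (fun k => if k is k'.+1 then eps k' else true)
    (fun k => if k is k'.+1 then f k' else fun=> 1) (fun=> 0) rv.
Proof.
move=> [H0 Hf] Hlv; split=> [[|k] le|[|k] n le] //; first exact: H0.
  by rewrite mul0r addr0 mulr1.
rewrite Hf //; congr (_ + _ * _).
by case: k le => [|k] le; rewrite // Hlv.
Qed.

Lemma strip_cut m eps f lv rv : strip m.+1 eps f lv rv ->
  strip m eps f lv (fun n => f m.+1 (n + ~~ eps m)%N).
Proof.
move=> [H0 Hf]; split=> [k le|k n le]; first by rewrite H0 // leqW.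
rewrite Hf; last exact: leqW.
congr (_ + _ * _); rewrite (leq_ltn_trans le (ltnSn m)).
by case: ltnP => // lt; have -> : k = m by lia.
Qed.

(** Coordinates of the vertex [k] on the staircase drawn by the orientation: [rises] gives its
    column, [falls] its row. *)
Fixpoint rises (eps : nat -> bool) k : nat := if k is k'.+1 then eps k' + rises eps k' else 0.
Fixpoint falls (eps : nat -> bool) k : nat := if k is k'.+1 then ~~ eps k' + falls eps k' else 0.

Lemma rises_falls eps k : (rises eps k + falls eps k = k)%N.
Proof. by elim: k => //= k IH; case: (eps k); rewrite /= ?add0n; lia. Qed.

Lemma rises_mono eps j k : (j <= k)%N -> (rises eps j <= rises eps k)%N.
Proof. by move/subnK<-; elim: (k - j)%N => //= i IH; rewrite (leq_trans IH) ?leq_addl. Qed.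

Lemma falls_mono eps j k : (j <= k)%N -> (falls eps j <= falls eps k)%N.
Proof. by move/subnK<-; elim: (k - j)%N => //= i IH; rewrite (leq_trans IH) ?leq_addl. Qed.

(* Induction on the time 2 (n + rises k) + (m - k) of the entry (k, n), which is larger than that of
   the entries its value is computed from. *)
Lemma strip_unique m eps f g lv rv lv' rv' :
  strip m eps f lv rv -> strip m eps g lv' rv' ->
  (forall k n, (k <= m)%N -> f k n != 0) ->
  (forall n, (forall i, (i <= n)%N -> f 0%N i = g 0%N i) -> lv n = lv' n) ->
  (forall n, (forall i, (i <= n)%N -> f m i = g m i) -> rv n = rv' n) ->
  forall k n, (k <= m)%N -> f k n = g k n.
Proof.
move=> [f0 Hf] [g0 Hg] nz Hl Hr k n.
have [t] := ubnP (2 * (n + rises eps k) + (m - k))%N.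
elim: t k n => // t IH k [|n] lt le; first by rewrite f0 ?g0.
apply: (mulfI (nz k n le)); rewrite Hf // (IH k n) //; last by lia.
rewrite Hg //; congr (_ + _ * _).
  case: k lt le => [|k] /= lt le; first by apply: Hl => i li; apply: IH => //=; lia.
  by apply: IH; lia.
case: ltnP => lt'; first by apply: IH => //=; case: (eps k) => /=; lia.
have E : k = m by lia.
by apply: Hr => i li; apply: IH => //; rewrite -E; lia.
Qed.

(** The bound [n + o] is exactly what a fork consumes at time [n]: when the arrow leaves the arm,
    the arm is known one step ahead of [g]. *)
Lemma arm_unique g g' o x x' n :
  arm g o x -> arm g' o x' -> (forall i, x i != 0) ->
  (forall i, (i <= n)%N -> g i = g' i) ->
  forall i, (i <= n + o)%N -> x i = x' i.
Proof.
move=> [x0 Hx] [x0' Hx'] nz Hg; elim=> [|i IH] le; first by rewrite x0.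
apply: (mulfI (nz i)); rewrite Hx (IH (ltnW le)) Hx' Hg //.
by move: le; case: o {Hx Hx' IH} => /=; lia.
Qed.

Lemma fork_unique g g' lv lv' o1 o2 x1 x2 y1 y2 :
  fork g lv o1 o2 x1 x2 -> fork g' lv' o1 o2 y1 y2 ->
  (forall i, x1 i != 0) -> (forall i, x2 i != 0) ->
  forall n, (forall i, (i <= n)%N -> g i = g' i) -> lv n = lv' n.
Proof.
move=> [a1 a2 Hl] [b1 b2 Hl'] n1 n2 n Hg.
by rewrite Hl Hl' (arm_unique _ _ _ _ _ _ a1 b1 n1 Hg) // (arm_unique _ _ _ _ _ _ a2 b2 n2 Hg).
Qed.

(** * Farey vectors along an orientation *)

Definition vec := (rat * rat)%type.
Definition cross (u v : vec) : rat := u.1 * v.2 - u.2 * v.1.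
Definition comb (c : rat) (u : vec) (d : rat) (v : vec) : vec :=
  (c * u.1 + d * v.1, c * u.2 + d * v.2).
Definition natvec (u : vec) := (u.1 \is a Num.nat) /\ (u.2 \is a Num.nat).
Definition intvec (u : vec) := (u.1 \is a Num.int) /\ (u.2 \is a Num.int).

(** This is the frise relation in disguise: for consecutive vectors [p, p'] and [q, q'] the first
    product on the right is 1. *)
Lemma plucker p p' q q' :
  cross p q * cross p' q' = cross p p' * cross q q' + cross p q' * cross p' q.
Proof. by rewrite /cross; ring. Qed.

Lemma vec_expand (a b u : vec) : cross a b = 1 -> u = comb (cross u b) a (cross a u) b.
Proof.
case: a b u => [a1 a2] [b1 b2] [u1 u2]; rewrite /cross /comb /= => H.
by congr pair; [rewrite -[LHS]mulr1 -H|rewrite -[LHS]mulr1 -H]; ring.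
Qed.

Lemma natvec_int u : natvec u -> intvec u.
Proof. by case=> h1 h2; split; apply: intr_nat. Qed.

Definition e1 : vec := (1, 0).
Definition e2 : vec := (0, 1).

Fixpoint farey (eps : nat -> bool) k : vec * vec :=
  if k is k'.+1 then
    let: (a, b) := farey eps k' in
    if eps k' then (comb 1 a 1 b, b) else (a, comb 1 b 1 a)
  else (e1, e2).

(* The first Farey vector in column x (row y) of the path of length k; constant beyond the path. *)
Fixpoint fcol (eps : nat -> bool) k x : vec :=
  if k is k'.+1 then
    if eps k' && (rises eps k' < x)%N then (farey eps k'.+1).1 else fcol eps k' x
  else e1.

Fixpoint frow (eps : nat -> bool) k y : vec :=
  if k is k'.+1 then
    if ~~ eps k' && (falls eps k' < y)%N then (farey eps k'.+1).2 else frow eps k' y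
  else e2.

Lemma natvec_comb c u d v : c \is a Num.nat -> d \is a Num.nat -> natvec u -> natvec v ->
  natvec (comb c u d v).
Proof. by move=> hc hd [u1 u2] [v1 v2]; split; rewrite /= rpredD ?rpredM. Qed.

Lemma intvec_comb c u d v : c \is a Num.int -> d \is a Num.int -> intvec u -> intvec v ->
  intvec (comb c u d v).
Proof. by move=> hc hd [u1 u2] [v1 v2]; split; rewrite /= rpredD ?rpredM. Qed.

Lemma int_cross u v : intvec u -> intvec v -> cross u v \is a Num.int.
Proof. by move=> [u1 u2] [v1 v2]; rewrite /cross rpredB ?rpredM. Qed.

Section Farey.
Variable eps : nat -> bool.
Local Notation a k := (farey eps k).1.
Local Notation b k := (farey eps k).2.

Lemma farey_cross k : cross (a k) (b k) = 1.
Proof.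
elim: k => [|k] /=; first by rewrite /cross /=; ring.
by case: (farey eps k) => u v; rewrite /cross; case: (eps k) => /= H; rewrite -[RHS]H; ring.
Qed.

Lemma farey_nat k : natvec (a k) /\ natvec (b k).
Proof.
elim: k => [|k] /=; first by split; split; rewrite /= ?rpred0 ?rpred1.
by case: (farey eps k) => u v [hu hv]; case: (eps k); split=> //=; apply: natvec_comb; rewrite ?rpred1.
Qed.

Lemma fcol_last k x : (rises eps k <= x)%N -> fcol eps k x = a k.
Proof.
elim: k => [|k IH] //=; case: (eps k) => /= le; first by rewrite ifT.
by rewrite IH //; case: (farey eps k).
Qed.

Lemma frow_last k y : (falls eps k <= y)%N -> frow eps k y = b k.
Proof.
elim: k => [|k IH] //=; case: (eps k) => /= le; last by rewrite ifT.
by rewrite IH //; case: (farey eps k).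
Qed.

Lemma fcol_at k j : (j <= k)%N -> fcol eps k (rises eps j) = a j.
Proof.
elim: k => [|k IH]; first by rewrite leqn0 => /eqP->.
rewrite leq_eqVlt => /orP[/eqP->|lt]; first exact: fcol_last.
by rewrite /= ltnNge rises_mono //= andbF IH.
Qed.

Lemma frow_at k j : (j <= k)%N -> frow eps k (falls eps j) = b j.
Proof.
elim: k => [|k IH]; first by rewrite leqn0 => /eqP->.
rewrite leq_eqVlt => /orP[/eqP->|lt]; first exact: frow_last.
by rewrite /= ltnNge falls_mono //= andbF IH.
Qed.

Lemma fcol0 k : fcol eps k 0 = e1.
Proof. exact: (fcol_at k 0). Qed.

Lemma frow0 k : frow eps k 0 = e2.
Proof. exact: (frow_at k 0). Qed.

Lemma fcol_cross k x : (x < rises eps k)%N -> cross (fcol eps k x) (fcol eps k x.+1) = 1.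
Proof.
elim: k => [|k IH] //=; case E: (eps k) => /= lt; last exact: IH.
have := farey_cross k; have [lt'|E'] : (x < rises eps k)%N \/ x = rises eps k by lia.
  by rewrite !ifF ?IH //; lia.
rewrite E' ltnn ltnSn fcol_last //; case: (farey eps k) => u v.
by rewrite /cross /= => H; rewrite -[RHS]H; ring.
Qed.

Lemma frow_cross k y : (y < falls eps k)%N -> cross (frow eps k y.+1) (frow eps k y) = 1.
Proof.
elim: k => [|k IH] //=; case E: (eps k) => /= lt; first exact: IH.
have := farey_cross k; have [lt'|E'] : (y < falls eps k)%N \/ y = falls eps k by lia.
  by rewrite !ifF ?IH //; lia.
rewrite E' ltnn ltnSn frow_last //; case: (farey eps k) => u v.
by rewrite /cross /= => H; rewrite -[RHS]H; ring.
Qed.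

Lemma fcol_nat k x : natvec (fcol eps k x).
Proof.
elim: k => [|k IH]; first exact: (farey_nat 0).1.
by rewrite [fcol _ _ _]/=; case: ifP => _ //; apply: (farey_nat k.+1).1.
Qed.

Lemma frow_nat k y : natvec (frow eps k y).
Proof.
elim: k => [|k IH]; first exact: (farey_nat 0).2.
by rewrite [frow _ _ _]/=; case: ifP => _ //; apply: (farey_nat k.+1).2.
Qed.

(** Up to the sign of the first, these are the coordinates of a row vector in the basis reached at
    [k]: all rows met on the way lie in the cone of [- a k] and [b k]. The signs of the later
    coefficients rest on this. *)
Lemma frow_coord k y : - cross (frow eps k y) (b k) \is a Num.nat /\
  cross (a k) (frow eps k y) \is a Num.nat.
Proof.
elim: k => [|k IH].
  by rewrite /cross /= !mulr0 !mulr1 !subrr !subr0 oppr0; split; rewrite ?rpred0 ?rpred1.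
have H := farey_cross k.+1; rewrite [frow _ _ _]/=; case: ifP => [_|_].
  rewrite H; split; last exact: rpred1.
  by rewrite (_ : cross _ _ = 0) ?oppr0 ?rpred0 // /cross; ring.
move: IH; rewrite /=; case: (farey eps k) => u v; case: (eps k) => /= -[h1 h2]; split=> //.
  rewrite (_ : cross _ _ = cross u (frow eps k y) + - cross (frow eps k y) v).
    exact: rpredD.
  by rewrite /cross /=; ring.
rewrite (_ : - cross _ _ = cross u (frow eps k y) + - cross (frow eps k y) v).
  exact: rpredD.
by rewrite /cross /=; ring.
Qed.

End Farey.

(** * Sequences repeating up to a linear map *)

Definition pext (N : nat) (M : vec -> vec) (w : nat -> vec) (i : nat) : vec :=
  iter (i %/ N) M (w (i %% N)%N).

Section PeriodicExtension.
Variables (N : nat) (M : vec -> vec) (w : nat -> vec).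
Hypotheses (N0 : (0 < N)%N) (wN : w N = M (w 0%N)).

Lemma pextD i : pext N M w (i + N) = M (pext N M w i).
Proof. by rewrite /pext modnDr divnDr ?dvdnn // divnn N0 addn1. Qed.

Lemma pext_small i : (i <= N)%N -> pext N M w i = w i.
Proof.
rewrite leq_eqVlt => /orP[/eqP->|lt]; last by rewrite /pext divn_small ?modn_small.
by rewrite /pext modnn divnn N0.
Qed.

Lemma pext_ind (P : vec -> Prop) i0 : (forall u, P u -> P (M u)) ->
  (forall i, (i0 <= i < i0 + N)%N -> P (pext N M w i)) ->
  forall i, (i0 <= i)%N -> P (pext N M w i).
Proof.
move=> HM Hw; elim/ltn_ind=> i IH le; case: (ltnP i (i0 + N)) => lt.
  by apply: Hw; rewrite le.
have -> : i = (i - N + N)%N by lia.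
by rewrite pextD; apply: HM; apply: IH; lia.
Qed.

(** Nothing special happens at the seam, because [w] is prescribed on [0..N] with both ends and [wN]
    makes the two values at [N] agree. *)
Lemma pext_cross : (forall u v, cross (M u) (M v) = cross u v) ->
  (forall i, (i < N)%N -> cross (w i) (w i.+1) = 1) ->
  forall i, cross (pext N M w i) (pext N M w i.+1) = 1.
Proof.
move=> HM Hw; elim/ltn_ind=> i IH; case: (ltnP i N) => lt.
  by rewrite !pext_small ?Hw // ltnW.
have -> : i = (i - N + N)%N by lia.
by rewrite -addSn !pextD HM IH //; lia.
Qed.

(** A recurrence with delay [N] whose coefficients are the matrix entries of [M]; [i0] skips initial
    vectors that may have a negative coordinate. *)
Lemma linrec_pext i0 (p : bool) : M =1 (fun u => comb u.1 (M e1) u.2 (M e2)) ->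
  natvec (M e1) -> natvec (M e2) ->
  (forall i, (i0 <= i < i0 + N)%N -> natvec (pext N M w i)) ->
  linrec (fun n => let v := pext N M w (n + i0) in if p then v.1 else v.2).
Proof.
move=> HM n1 n2 H0.
apply: (@linrec_delay bool N
  (fun p n => let v := pext N M w (n + i0) in if p then v.1 else v.2)
  (fun p q => let v := if q then M e1 else M e2 in if p then v.1 else v.2)) => //.
- by move=> [] [] /=; case: n1 n2 => ? ? [].
- by move=> [] n lt /=; case: (H0 (n + i0)%N) => //; lia.
move=> q n; rewrite big_bool /= addnAC pextD HM /comb.
by case: q => /=; rewrite mulrC [X in _ + X]mulrC.
Qed.

End PeriodicExtension.

(** * The solution on a chain *)

Section StripSolution.
Variables (m : nat) (eps : nat -> bool) (A B A' B' : rat).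
Local Notation a := (farey eps m).1.
Local Notation b := (farey eps m).2.
Local Notation X := (rises eps m).
Local Notation N := m.+2.

(* Gluing maps at the two ends: A = B = 0 beyond a vertex of constant value 1, and A * B = 4 (a
   parabolic map) at a fork. The right one is written in the basis (a, b) reached by the path. *)
Definition glueL (u : vec) : vec := (- u.1 - B * u.2, A * u.1 + (A * B - 1) * u.2).
Definition glueR (u : vec) : vec :=
  let c1 := cross u b in let c2 := cross a u in
  comb (c1 - B' * c2) a (A' * c1 + (1 - A' * B') * c2) b.
Definition unglueR (u : vec) : vec :=
  let c1 := cross u b in let c2 := cross a u in
  comb ((1 - A' * B') * c1 + B' * c2) a (c2 - A' * c1) b.
Definition monod (u : vec) : vec := unglueR (glueL u).

(** Both Farey sequences in one: the columns in increasing order at indices [1..X+1], then the rows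
    in decreasing order, pulled back by the right gluing, up to index [N]. The value at 0 is the
    vector that [glueL] sends to [e2], the row 0. *)
Definition wstrip (i : nat) : vec :=
  if i is i'.+1 then
    if (i' <= X)%N then fcol eps m i' else unglueR (frow eps m (N - i)%N)
  else (B, -1).
Definition vstrip : nat -> vec := pext N monod wstrip.
(** At [n = 0] the indices select the column [rises eps k] and the row [falls eps k], a Farey pair,
    of determinant 1. *)
Definition tile (k n : nat) : rat :=
  cross (vstrip (n + rises eps k).+1) (glueR (vstrip (n + rises eps k + N - k)%N)).
(** The boundary factors are the entries of the same tiling at the virtual vertices [-1] and
    [m + 1]; there both arguments come from one vector, which leaves a quadratic form. *)
Definition lval (n : nat) : rat := cross (vstrip n.+1) (glueL (vstrip n.+1)).
Definition rval (n : nat) : rat := cross (vstrip (n + X).+2) (glueR (vstrip (n + X).+2)).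

Let ab1 : cross a b = 1 := farey_cross eps m.

Let coordl c d : cross (comb c a d b) b = c.
Proof. by rewrite -[RHS]mulr1 -[in RHS]ab1 /cross /=; ring. Qed.

Let coordr c d : cross a (comb c a d b) = d.
Proof. by rewrite -[RHS]mulr1 -[in RHS]ab1 /cross /=; ring. Qed.

Lemma unglueRK u : glueR (unglueR u) = u.
Proof.
rewrite /glueR /unglueR coordl coordr [RHS](vec_expand _ _ _ ab1).
by congr comb; ring.
Qed.

Lemma glueL_cross u v : cross (glueL u) (glueL v) = cross u v.
Proof. by rewrite /cross /=; ring. Qed.

Lemma glueR_cross u v : cross (glueR u) (glueR v) = cross u v.
Proof.
transitivity (cross u v * cross a b ^+ 2); last by rewrite ab1 expr1n mulr1.
by rewrite /glueR /cross /comb /=; ring.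
Qed.

Lemma unglueR_cross u v : cross (unglueR u) (unglueR v) = cross u v.
Proof. by rewrite -glueR_cross !unglueRK. Qed.

Lemma monod_cross u v : cross (monod u) (monod v) = cross u v.
Proof. by rewrite /monod unglueR_cross glueL_cross. Qed.

Lemma wstrip_N : wstrip N = monod (wstrip 0).
Proof.
have h := rises_falls eps m; rewrite /wstrip /monod ifF; last by lia.
by rewrite subnn frow0 /glueL /=; congr unglueR; rewrite /e2; congr pair; ring.
Qed.

Lemma wstrip_cross i : (i < N)%N -> cross (wstrip i) (wstrip i.+1) = 1.
Proof.
have h := rises_falls eps m; case: i => [|i] lt.
  by rewrite /= fcol0 /cross /=; ring.
rewrite /wstrip; case: (ltngtP i X) => lt'.
- by rewrite fcol_cross.
- rewrite unglueR_cross -[X in frow eps m X](@subnSK (i.+1) N) // frow_cross //; lia.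
rewrite lt' fcol_last // frow_last; last by lia.
by rewrite /unglueR coordr ab1 /cross; ring.
Qed.

Let wN := wstrip_N.
Lemma vstrip_cross i : cross (vstrip i) (vstrip i.+1) = 1.
Proof. exact: (pext_cross _ _ _ _ wN monod_cross wstrip_cross). Qed.

Lemma vstripD i : vstrip (i + N) = monod (vstrip i).
Proof. exact: pextD. Qed.

Lemma glueR_vstripD i : glueR (vstrip (i + N)) = glueL (vstrip i).
Proof. by rewrite vstripD unglueRK. Qed.

Lemma vstrip_small i : (i <= N)%N -> vstrip i = wstrip i.
Proof. exact: pext_small. Qed.

Lemma strip_tile : strip m eps tile lval rval.
Proof.
split=> [k le|k n le].
  have h := rises_falls eps k; have h' := rises_mono eps _ _ le.
  have h2 := rises_falls eps m; have h3 := falls_mono eps _ _ le.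
  rewrite /tile add0n !vstrip_small; [|lia|lia].
  rewrite /wstrip h' fcol_at //.
  have -> : (rises eps k + N - k = (N - falls eps k).-1.+1)%N by lia.
  rewrite ifF; last by lia.
  rewrite unglueRK (_ : N - _ = falls eps k)%N; last by lia.
  by rewrite frow_at // farey_cross.
rewrite /tile addSn; set c := (n + rises eps k)%N.
have -> : (c.+1 + N - k = (c + N - k).+1)%N by lia.
rewrite plucker vstrip_cross glueR_cross vstrip_cross mulr1; congr (_ + _ * _).
  case: k le @c => [|k] le c.
    by rewrite subn0 /lval -addSn glueR_vstripD /c addn0.
  by rewrite -addnA -/(rises eps k.+1) -/c -subSn ?subSS //; lia.
case: ltnP => lt.
  have -> : (n + ~~ eps k + rises eps k.+1 = c.+1)%N by rewrite /c /=; case: (eps k) => /=; lia.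
  by have -> : (c.+1 + N - k.+1 = c + N - k)%N by lia.
have E : k = m by lia.
by rewrite /rval /c E; have -> : (n + X + N - m = (n + X).+2)%N by lia.
Qed.

End StripSolution.

(** * Forks at the ends of a chain *)

Ltac rpred_all :=
  repeat first [done | exact: rpred1 | exact: rpred0 | rewrite rpredN | apply: rpredD | apply: rpredM].

(* A fork with arms oriented as o1, o2 glues along g (s1 u1 + s2 u2)^2. With opposite orientations
   g = 2, and the factor 2 is carried alternately by the two arms: this is [par]. *)
Definition fs1 (o1 o2 : bool) : rat := if o1 && o2 then 2 else 1.
Definition fs2 (o1 o2 : bool) : rat := if o1 || o2 then 1 else 2.
Definition fg (o1 o2 : bool) : rat := if o1 == o2 then 1 else 2.
Definition fA o1 o2 := fg o1 o2 * fs1 o1 o2 ^+ 2.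
Definition fB o1 o2 := fg o1 o2 * fs2 o1 o2 ^+ 2.
Definition par (o1 o2 : bool) (n : nat) : rat := if (o1 != o2) && odd n then 2 else 1.

Lemma fAB o1 o2 : fA o1 o2 * fB o1 o2 = 4.
Proof. by rewrite /fA /fB /fg /fs1 /fs2; case: o1; case: o2 => /=; ring. Qed.

Lemma par_mul o1 o2 n : par o1 o2 n * par o1 o2 n.+1 = fg o1 o2.
Proof. by rewrite /par /fg /=; case: o1; case: o2; case: (odd n) => /=; ring. Qed.

Lemma par_arms o1 o2 n : par o1 o2 (n + o1) * par o1 o2 (n + o2) = fg o1 o2.
Proof. by rewrite /par /fg !oddD; case: o1; case: o2; case: (odd n) => /=; ring. Qed.

Lemma fork_nat o1 o2 : [/\ fA o1 o2 \is a Num.nat, fB o1 o2 \is a Num.nat,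
  fs1 o1 o2 \is a Num.nat & fs2 o1 o2 \is a Num.nat].
Proof.
have hf : fg o1 o2 \is a Num.nat by rewrite /fg; case: ifP.
have h1 : fs1 o1 o2 \is a Num.nat by rewrite /fs1; case: ifP.
have h2 : fs2 o1 o2 \is a Num.nat by rewrite /fs2; case: ifP.
by split=> //; rewrite rpredM // rpredX.
Qed.

Lemma par_nat o1 o2 n : par o1 o2 n \is a Num.nat.
Proof. by rewrite /par; case: ifP. Qed.

Lemma linrec_par o1 o2 : linrec (par o1 o2).
Proof.
apply: (@linrec_periodic 2) => // n; first exact: par_nat.
by rewrite /par addn2 /= negbK.
Qed.

Definition sigma o1 o2 (u : vec) : rat := fs1 o1 o2 * u.1 + fs2 o1 o2 * u.2.

(** A symmetric form of rank one plus the determinant. For [u = w] it is the square that the fork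
    contributes; for consecutive vectors it says that 1 plus the entry at the end vertex is a
    product of consecutive values of an arm. *)
Lemma cross_glueL o1 o2 u w : cross u (glueL (fA o1 o2) (fB o1 o2) w) =
  fg o1 o2 * sigma o1 o2 u * sigma o1 o2 w + cross u w.
Proof. by rewrite /sigma /cross /glueL /fA /fB /fg /fs1 /fs2; case: o1; case: o2 => /=; ring. Qed.

Section Forks.
Variables (m : nat) (eps : nat -> bool).
Local Notation a := (farey eps m).1.
Local Notation b := (farey eps m).2.
Local Notation X := (rises eps m).
Local Notation N := m.+2.
Let ab1 : cross a b = 1 := farey_cross eps m.

Definition armL o1 o2 A' B' (o : bool) n : rat :=
  sigma o1 o2 (vstrip m eps (fA o1 o2) (fB o1 o2) A' B' (n + ~~ o)) * par o1 o2 n.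

Lemma tile0E A B A' B' n : tile m eps A B A' B' 0 n =
  cross (vstrip m eps A B A' B' n.+1) (glueL A B (vstrip m eps A B A' B' n)).
Proof. by rewrite /tile /= addn0 subn0 glueR_vstripD. Qed.

Lemma fork_left o1 o2 A' B' :
  fork (tile m eps (fA o1 o2) (fB o1 o2) A' B' 0) (lval m eps (fA o1 o2) (fB o1 o2) A' B')
    o1 o2 (armL o1 o2 A' B' o1) (armL o1 o2 A' B' o2).
Proof.
set A := fA o1 o2; set B := fB o1 o2.
have Harm o : o \in [:: o1; o2] -> arm (tile m eps A B A' B' 0) o (armL o1 o2 A' B' o).
  move=> ho; split.
    (* This initial value fixes the constants: an arm starts at [e1] when its arrow enters it, which
       needs [s1 = 1], and at [(B, -1)] when its arrow leaves it, which needs [s1 * B - s2 = 1]. *)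
    rewrite /armL add0n vstrip_small; last by case: (o).
    move: ho; case: (o) => /=; rewrite ?fcol0 /sigma /B /fB /par /fg /fs1 /fs2;
      by case: (o1); case: (o2) => //= _; ring.
  move=> n; rewrite /armL mulrACA par_mul tile0E cross_glueL addSn -/A -/B.
  set u := vstrip _ _ _ _ _ _ _; set w := vstrip _ _ _ _ _ _ _.
  have : cross u w = 1 by apply: vstrip_cross.
  have -> : cross w u = - cross u w by rewrite /cross; ring.
  by move=> ->; ring.
split; [by apply: Harm; rewrite inE eqxx | by apply: Harm; rewrite !inE eqxx orbT |].
move=> n; rewrite /armL mulrACA par_arms /lval cross_glueL -/A -/B.
have -> : (n + o1 + ~~ o1 = n.+1)%N by case: (o1) => /=; lia.
have -> : (n + o2 + ~~ o2 = n.+1)%N by case: (o2) => /=; lia.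
by set u := vstrip _ _ _ _ _ _ _; rewrite (_ : cross u u = 0) /cross; ring.
Qed.

Definition tau q1 q2 (u : vec) : rat :=
  fs1 (~~ q1) (~~ q2) * cross u b - fs2 (~~ q1) (~~ q2) * cross a u.

Lemma cross_coord u w : cross u w = cross u b * cross a w - cross a u * cross w b.
Proof. by rewrite -[LHS]mulr1 -ab1 /cross; ring. Qed.

Lemma cross_glueR q1 q2 u w :
  cross u (glueR m eps (fA (~~ q1) (~~ q2)) (fB (~~ q1) (~~ q2)) w) =
  fg q1 q2 * tau q1 q2 u * tau q1 q2 w - cross u w.
Proof.
set A' := fA _ _; set B' := fB _ _; rewrite [X in _ - X]cross_coord.
transitivity (A' * cross u b * cross w b + (1 - A' * B') * cross u b * cross a w
   - cross a u * cross w b + B' * cross a u * cross a w).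
  by rewrite /glueR /cross /comb /=; ring.
by rewrite /tau /A' /B' /fA /fB /fg /fs1 /fs2; case: (q1); case: (q2) => /=; ring.
Qed.

Definition armR A B q1 q2 (q : bool) n : rat :=
  tau q1 q2 (vstrip m eps A B (fA (~~ q1) (~~ q2)) (fB (~~ q1) (~~ q2)) (n + ~~ q + X).+1)
  * par q1 q2 n.

(** The orientations are negated because here the Farey vector [a] starts an arm whose arrow leaves
    it, whereas [e1] at the left starts an arm whose arrow enters it. *)
Lemma fork_right A B q1 q2 :
  fork (tile m eps A B (fA (~~ q1) (~~ q2)) (fB (~~ q1) (~~ q2)) m)
    (rval m eps A B (fA (~~ q1) (~~ q2)) (fB (~~ q1) (~~ q2)))
    q1 q2 (armR A B q1 q2 q1) (armR A B q1 q2 q2).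
Proof.
set A' := fA _ _; set B' := fB _ _; have h := rises_falls eps m.
have Harm q : q \in [:: q1; q2] -> arm (tile m eps A B A' B' m) q (armR A B q1 q2 q).
  move=> hq; split.
    rewrite /armR add0n vstrip_small; last by case: (q) => /=; lia.
    rewrite -/A' -/B' /wstrip; case: q hq => hq /=.
      rewrite add0n leqnn fcol_last // /tau ab1 (_ : cross a a = 0); last by rewrite /cross; ring.
      by move: hq; rewrite /par /fs1; case: (q1); case: (q2) => //= _; ring.
    rewrite ltnn frow_last; last by lia.
    rewrite /tau /unglueR ab1 (_ : cross b b = 0); last by rewrite /cross; ring.
    set u := comb _ _ _ _.
    have -> : cross u b = B' by rewrite -[RHS]mulr1 -[in RHS]ab1 /u /cross /=; ring.
    have -> : cross a u = 1 by rewrite -[RHS]ab1 /u /cross /=; ring.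
    by move: hq; rewrite /B' /par /fB /fg /fs1 /fs2; case: (q1); case: (q2) => //= _; ring.
  move=> n; rewrite /armR mulrACA par_mul /tile -/A' -/B' [(n.+1 + _)%N]addSn addSn.
  have -> : (n + ~~ q + X + N - m = (n + ~~ q + X).+2)%N by lia.
  by rewrite cross_glueR vstrip_cross; ring.
split; [by apply: Harm; rewrite inE eqxx | by apply: Harm; rewrite !inE eqxx orbT |].
move=> n; rewrite /armR mulrACA par_arms /rval cross_glueR -/A' -/B'.
have -> : (n + q1 + ~~ q1 = n.+1)%N by case: (q1) => /=; lia.
have -> : (n + q2 + ~~ q2 = n.+1)%N by case: (q2) => /=; lia.
by rewrite addSn; set u := vstrip _ _ _ _ _ _ _; rewrite (_ : cross u u = 0) /cross; ring.
Qed.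

(** The right gluing has trace -2 here, and [tau] is its eigenform, with eigenvalue -1. *)
Lemma tau_monod A B q1 q2 u :
  tau q1 q2 (monod m eps A B (fA (~~ q1) (~~ q2)) (fB (~~ q1) (~~ q2)) u) =
  - tau q1 q2 (glueL A B u).
Proof.
rewrite /monod; move: (glueL A B u) => {}u; rewrite /unglueR.
set c := _ + _; set d := _ - _.
have H : tau q1 q2 (comb c a d b) = fs1 (~~ q1) (~~ q2) * c - fs2 (~~ q1) (~~ q2) * d.
  transitivity ((fs1 (~~ q1) (~~ q2) * c - fs2 (~~ q1) (~~ q2) * d) * cross a b).
    by rewrite /tau /cross /=; ring.
  by rewrite ab1 mulr1.
rewrite H /c /d /tau /fA /fB /fg /fs1 /fs2.
by case: (q1); case: (q2) => /=; ring.
Qed.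

Lemma vstrip_int A B A' B' i : A \is a Num.int -> B \is a Num.int ->
  A' \is a Num.int -> B' \is a Num.int -> intvec (vstrip m eps A B A' B' i).
Proof.
move=> iA iB iA' iB'.
have [/natvec_int na /natvec_int nb] := farey_nat eps m.
have iL u : intvec u -> intvec (glueL A B u).
  by move=> [u1 u2]; split=> /=; rpred_all.
have iR u : intvec u -> intvec (unglueR m eps A' B' u).
  move=> iu; have i1 := int_cross _ _ iu nb; have i2 := int_cross _ _ na iu.
  by apply: intvec_comb => //; rpred_all.
apply: (pext_ind _ _ _ _ intvec 0) => // [u iu|j]; first exact/iR/iL.
rewrite add0n => /andP[_ lt]; rewrite pext_small //; last exact: ltnW.
  rewrite /wstrip; case: j lt => [|j] lt; first by split; rewrite //= rpredN rpred1.
  by case: ifP => _; [apply/natvec_int/fcol_nat|apply/iR/natvec_int/frow_nat].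
exact: wstrip_N.
Qed.

Lemma tile_int A B A' B' k n : A \is a Num.int -> B \is a Num.int ->
  A' \is a Num.int -> B' \is a Num.int -> tile m eps A B A' B' k n \is a Num.int.
Proof.
move=> iA iB iA' iB'; apply: int_cross; first exact: vstrip_int.
set u := vstrip _ _ _ _ _ _ _; have iu : intvec u by apply: vstrip_int.
have [/natvec_int na /natvec_int nb] := farey_nat eps m.
have i1 := int_cross _ _ iu nb; have i2 := int_cross _ _ na iu.
by apply: intvec_comb => //; rpred_all.
Qed.

Lemma armL_int o1 o2 A' B' o n : A' \is a Num.int -> B' \is a Num.int ->
  armL o1 o2 A' B' o n \is a Num.int.
Proof.
move=> iA' iB'; have [nA nB n1 n2] := fork_nat o1 o2.
have [u1 u2] : intvec (vstrip m eps (fA o1 o2) (fB o1 o2) A' B' (n + ~~ o)).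
  by apply: vstrip_int => //; apply: intr_nat.
by apply: rpredM; [apply: rpredD; apply: rpredM|] => //; apply: intr_nat => //; apply: par_nat.
Qed.

Lemma armR_int A B q1 q2 q n : A \is a Num.int -> B \is a Num.int ->
  armR A B q1 q2 q n \is a Num.int.
Proof.
move=> iA iB; have [nA nB n1 n2] := fork_nat (~~ q1) (~~ q2).
have [/natvec_int na /natvec_int nb] := farey_nat eps m.
apply: rpredM; last by apply: intr_nat; apply: par_nat.
by apply: rpredB; apply: rpredM; (try by apply: intr_nat); apply: int_cross => //;
  apply: vstrip_int => //; apply: intr_nat.
Qed.

End Forks.

(** * Chains with a free end *)

Lemma pos_int_nat (x : rat) : 0 < x -> x \is a Num.int -> x \is a Num.nat.
Proof. by move=> x0 xi; rewrite natrEint xi ltW. Qed.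

(** As the left gluing is -1, one turn applies the same map of determinant 1 to both arguments of
    the determinant, whatever the right end is. *)
Lemma tile_periodic m eps A' B' k n : (k <= m)%N ->
  tile m eps 0 0 A' B' k (n + m.+2) = tile m eps 0 0 A' B' k n.
Proof.
move=> le; rewrite /tile; set c := (n + rises eps k)%N.
have -> : (n + m.+2 + rises eps k).+1 = (c.+1 + m.+2)%N by lia.
have -> : (n + m.+2 + rises eps k + m.+2 - k)%N = (c + m.+2 - k + m.+2)%N by lia.
rewrite glueR_vstripD vstripD -(glueR_cross m eps A' B') unglueRK.
by rewrite /glueR /cross /comb /=; ring.
Qed.

Lemma armR_periodic m eps q1 q2 q n :
  armR m eps 0 0 q1 q2 q (n + m.+2.*2) = armR m eps 0 0 q1 q2 q n.
Proof.
have H i : tau m eps q1 q2 (vstrip m eps 0 0 (fA (~~ q1) (~~ q2)) (fB (~~ q1) (~~ q2)) (i + m.+2)) =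
    tau m eps q1 q2 (vstrip m eps 0 0 (fA (~~ q1) (~~ q2)) (fB (~~ q1) (~~ q2)) i).
  by rewrite vstripD tau_monod /tau /cross /=; ring.
(* The linear form alone has period [m + 2]; the period is doubled because [par] may alternate and
   [m + 2] may be odd. *)
rewrite /armR; congr (_ * _); last by rewrite /par oddD odd_double addbF.
have -> : (n + m.+2.*2 + ~~ q + rises eps m).+1 =
  ((n + ~~ q + rises eps m).+1 + m.+2 + m.+2)%N by lia.
by rewrite !H.
Qed.

Lemma linrec_strip_const_const m eps f lv rv : strip m eps f lv rv ->
  (forall k n, (k <= m)%N -> 0 < f k n) -> lv =1 (fun=> 0) -> rv =1 (fun=> 0) ->
  forall k, (k <= m)%N -> linrec (f k).
Proof.
move=> Hs Hp Hl Hr.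
have E : forall k n, (k <= m)%N -> f k n = tile m eps 0 0 0 0 k n.
  apply: (strip_unique _ _ _ _ _ _ _ _ Hs (strip_tile _ _ _ _ _ _)) => [k n le|n _|n _].
  - by rewrite gt_eqF ?Hp.
  - by rewrite Hl /lval /cross /=; ring.
  by rewrite Hr /rval /glueR /comb /cross /=; ring.
move=> k le; apply: (@linrec_periodic m.+2) => // n.
  by apply: pos_int_nat; [exact: Hp|rewrite E // tile_int].
by rewrite !E // tile_periodic.
Qed.

Lemma linrec_strip_const_fork m eps f lv rv q1 q2 z1 z2 : strip m eps f lv rv ->
  (forall k n, (k <= m)%N -> 0 < f k n) -> lv =1 (fun=> 0) ->
  fork (f m) rv q1 q2 z1 z2 -> (forall n, 0 < z1 n) -> (forall n, 0 < z2 n) ->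
  [/\ forall k, (k <= m)%N -> linrec (f k), linrec z1 & linrec z2].
Proof.
move=> Hs Hp Hl Hr p1 p2; have [nA nB _ _] := fork_nat (~~ q1) (~~ q2).
have F := fork_right m eps 0 0 q1 q2; move: nA nB F.
set A' := fA _ _; set B' := fB _ _ => nA nB F.
have E : forall k n, (k <= m)%N -> f k n = tile m eps 0 0 A' B' k n.
  apply: (strip_unique _ _ _ _ _ _ _ _ Hs (strip_tile _ _ _ _ _ _)) => [k n le|n _|].
  - by rewrite gt_eqF ?Hp.
  - by rewrite Hl /lval /cross /=; ring.
  by apply: (fork_unique _ _ _ _ _ _ _ _ _ _ Hr F) => i; rewrite gt_eqF.
case: Hr F => a1 a2 _ [b1 b2 _].
have Harm z q : arm (f m) q z -> arm (tile m eps 0 0 A' B' m) q (armR m eps 0 0 q1 q2 q) ->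
    (forall n, 0 < z n) -> linrec z.
  move=> az bz pz; have Ez n : z n = armR m eps 0 0 q1 q2 q n.
    apply: (arm_unique _ _ _ _ _ n az bz) => [i|i _|]; rewrite ?leq_addr ?gt_eqF //.
    exact: E.
  apply: (@linrec_periodic m.+2.*2) => // n; last by rewrite !Ez armR_periodic.
  by apply: pos_int_nat; rewrite // Ez armR_int.
split; [|exact: Harm a1 b1 p1|exact: Harm a2 b2 p2].
move=> k le; apply: (@linrec_periodic m.+2) => // n; last by rewrite !E // tile_periodic.
by apply: pos_int_nat; [exact: Hp|rewrite E // tile_int // intr_nat].
Qed.

(** * Chains with a fork at each end *)

Section ForkFork.
Variables (m : nat) (eps : nat -> bool) (o1 o2 q1 q2 : bool).
Local Notation A := (fA o1 o2).
Local Notation B := (fB o1 o2).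
Local Notation A' := (fA (~~ q1) (~~ q2)).
Local Notation B' := (fB (~~ q1) (~~ q2)).
Local Notation a := (farey eps m).1.
Local Notation b := (farey eps m).2.
Local Notation v := (vstrip m eps A B A' B').

(** [glueL] carries the first quadrant into the cone of [- a] and [b], and [unglueR] carries this
    cone back into the first quadrant. So the monodromy has entries in N although neither factor
    need have them. *)
Lemma unglueR_nat u : - cross u b \is a Num.nat -> cross a u \is a Num.nat ->
  natvec (unglueR m eps A' B' u).
Proof.
have [nA nB _ _] := fork_nat (~~ q1) (~~ q2); have [na nb] := farey_nat eps m.
move=> h1 h2; apply: natvec_comb => //.
  rewrite fAB (_ : _ + _ = 3 * - cross u b + B' * cross a u); last by ring.
  by rpred_all.
rewrite (_ : _ - _ = cross a u + A' * - cross u b); last by ring.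
by rpred_all.
Qed.

Lemma glueL_coord u : natvec u -> - cross (glueL A B u) b \is a Num.nat /\
  cross a (glueL A B u) \is a Num.nat.
Proof.
have [nA nB _ _] := fork_nat o1 o2; have [[na1 na2] [nb1 nb2]] := farey_nat eps m.
move=> [u1 u2]; rewrite /cross /glueL /= fAB.
have h3 : (3 : rat) \is a Num.nat by [].
rewrite (_ : - _ = (u.1 + B * u.2) * b.2 + (A * u.1 + 3 * u.2) * b.1); last by ring.
rewrite (_ : a.1 * _ - _ = a.1 * (A * u.1 + 3 * u.2) + a.2 * (u.1 + B * u.2)); last by ring.
by split; rpred_all.
Qed.

Lemma monod_nat u : natvec u -> natvec (monod m eps A B A' B' u).
Proof. by move=> /glueL_coord[h1 h2]; apply: unglueR_nat. Qed.

Lemma vstrip_nat i : (0 < i)%N -> natvec (v i).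
Proof.
apply: (pext_ind _ _ _ _ natvec 1) => // [u|j /andP[j0 lt]]; first exact: monod_nat.
rewrite pext_small //; last exact: wstrip_N.
rewrite /wstrip; case: j j0 lt => // j _ lt; case: ifP => _; first exact: fcol_nat.
by have [h1 h2] := frow_coord eps m (m.+2 - j.+1)%N; apply: unglueR_nat.
Qed.

Lemma linrec_vstrip i : (0 < i)%N ->
  linrec (fun n => (v (n + i)).1) /\ linrec (fun n => (v (n + i)).2).
Proof.
have H p : linrec (fun n => let u := v (n + 1) in if p then u.1 else u.2).
  apply: linrec_pext => //.
  - by move=> u; rewrite /monod /unglueR /glueL /comb /cross /=; congr pair; ring.
  - by apply: monod_nat; split.
  - by apply: monod_nat; split.
  by move=> j /andP[j0 _]; apply: vstrip_nat.
case: i => // i _; split.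
  by apply: eq_linrec (linrec_shift _ i (H true)) => n; rewrite -addnA addn1.
by apply: eq_linrec (linrec_shift _ i (H false)) => n; rewrite -addnA addn1.
Qed.

Lemma linrec_form c d i : (0 < i)%N -> c \is a Num.nat -> d \is a Num.nat ->
  linrec (fun n => c * (v (n + i)).1 + d * (v (n + i)).2).
Proof. by move=> /linrec_vstrip[h1 h2] nc nd; apply: linrecD; apply: linrecZ. Qed.

Lemma linrec_tile k : (k <= m)%N ->
  linrec (fun n => tile m eps A B A' B' k (n + m.+2)).
Proof.
move=> le; have [nA nB _ _] := fork_nat o1 o2.
have h3 : (3 : rat) \is a Num.nat by [].
(* One turn later the second argument is [glueL (v (n + j))], in the second quadrant; the
   determinant becomes the form over N with coefficients [A], [3 = A * B - 1], [1] and [B]. *)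
pose i := (m.+2 + rises eps k).+1; pose j := (m.+2 + rises eps k - k)%N.
have j0 : (0 < j)%N by rewrite /j; lia.
have [hi1 hi2] := linrec_vstrip i isT.
have H : linrec (fun n => (v (n + i)).1 * (A * (v (n + j)).1 + 3 * (v (n + j)).2)
                       + (v (n + i)).2 * (1 * (v (n + j)).1 + B * (v (n + j)).2)).
  by apply: linrecD; apply: linrecM => //; apply: linrec_form.
apply: eq_linrec H => n; rewrite /tile.
have -> : (n + m.+2 + rises eps k + m.+2 - k = n + j + m.+2)%N by rewrite /j; lia.
have -> : (n + m.+2 + rises eps k).+1 = (n + i)%N by rewrite /i; lia.
by rewrite glueR_vstripD /cross /glueL /= fAB; ring.
Qed.

Lemma linrec_armL o : linrec (fun n => armL m eps o1 o2 A' B' o (n + 1)).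
Proof.
have [_ _ n1 n2] := fork_nat o1 o2.
apply: linrecM; last exact: linrec_shift (linrec_par _ _).
apply: eq_linrec (linrec_form (fs1 o1 o2) (fs2 o1 o2) (~~ o).+1 isT n1 n2) => n.
by rewrite /sigma addn1 addSnnS.
Qed.

Lemma linrec_armR q : linrec (fun n => armR m eps A B q1 q2 q (n + m.+2)).
Proof.
have [_ _ n1 n2] := fork_nat (~~ q1) (~~ q2).
apply: linrecM; last exact: linrec_shift (linrec_par _ _).
pose i := (~~ q + rises eps m).+1.
(* [tau] itself has mixed signs; after one turn it becomes [- tau (glueL u)], which is nonnegative
   by [glueL_coord]. *)
pose L u : rat := fs1 (~~ q1) (~~ q2) * - cross (glueL A B u) b + fs2 (~~ q1) (~~ q2) * cross a (glueL A B u).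
have nL u : natvec u -> L u \is a Num.nat by move=> /glueL_coord[h1 h2]; rewrite /L; rpred_all.
have ne1 : L e1 \is a Num.nat by apply: nL.
have ne2 : L e2 \is a Num.nat by apply: nL.
apply: eq_linrec (linrec_form (L e1) (L e2) i isT ne1 ne2) => n.
have -> : (n + m.+2 + ~~ q + rises eps m).+1 = (n + i + m.+2)%N by rewrite /i; lia.
by rewrite vstripD tau_monod /tau /L /glueL /cross /=; ring.
Qed.

End ForkFork.

Lemma linrec_strip_fork_fork m eps f lv rv o1 o2 x1 x2 q1 q2 z1 z2 : strip m eps f lv rv ->
  (forall k n, (k <= m)%N -> 0 < f k n) ->
  fork (f 0%N) lv o1 o2 x1 x2 -> (forall n, 0 < x1 n) -> (forall n, 0 < x2 n) ->
  fork (f m) rv q1 q2 z1 z2 -> (forall n, 0 < z1 n) -> (forall n, 0 < z2 n) ->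
  [/\ forall k, (k <= m)%N -> linrec (f k), linrec x1, linrec x2, linrec z1 & linrec z2].
Proof.
move=> Hs Hp Hl px1 px2 Hr pz1 pz2.
have [nA nB _ _] := fork_nat o1 o2; have [nA' nB' _ _] := fork_nat (~~ q1) (~~ q2).
have FL := fork_left m eps o1 o2 (fA (~~ q1) (~~ q2)) (fB (~~ q1) (~~ q2)).
have FR := fork_right m eps (fA o1 o2) (fB o1 o2) q1 q2.
have E : forall k n, (k <= m)%N -> f k n = tile m eps (fA o1 o2) (fB o1 o2) (fA (~~ q1) (~~ q2)) (fB (~~ q1) (~~ q2)) k n.
  apply: (strip_unique _ _ _ _ _ _ _ _ Hs (strip_tile _ _ _ _ _ _)) => [k n le||].
  - by rewrite gt_eqF ?Hp.
  - by apply: (fork_unique _ _ _ _ _ _ _ _ _ _ Hl FL) => i; rewrite gt_eqF.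
  by apply: (fork_unique _ _ _ _ _ _ _ _ _ _ Hr FR) => i; rewrite gt_eqF.
have Harm p k q z w : (k <= m)%N -> arm (f k) q z ->
    arm (tile m eps (fA o1 o2) (fB o1 o2) (fA (~~ q1) (~~ q2)) (fB (~~ q1) (~~ q2)) k) q w ->
    (forall n, 0 < z n) -> (forall n, w n \is a Num.int) -> linrec (fun n => w (n + p)%N) -> linrec z.
  move=> le az bz pz iw lw; have Ez n : z n = w n.
    apply: (arm_unique _ _ _ _ _ n az bz) => [i|i _|]; rewrite ?leq_addr ?gt_eqF //.
    exact: E.
  apply: (linrec_prefix p) => [n _|]; first by apply: pos_int_nat; rewrite // Ez.
  by apply: eq_linrec lw => n; rewrite Ez.
case: Hl FL => a1 a2 _ [b1 b2 _]; case: Hr FR => c1 c2 _ [d1 d2 _].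
split.
- move=> k le; apply: (linrec_prefix m.+2) => [n _|].
    by apply: pos_int_nat; [exact: Hp|rewrite E // tile_int // intr_nat].
  by apply: eq_linrec (linrec_tile m eps o1 o2 q1 q2 k le) => n; rewrite E.
- by apply: (Harm 1%N _ _ _ _ _ a1 b1) => // [n|]; [rewrite armL_int ?intr_nat|apply: linrec_armL].
- by apply: (Harm 1%N _ _ _ _ _ a2 b2) => // [n|]; [rewrite armL_int ?intr_nat|apply: linrec_armL].
- by apply: (Harm m.+2 _ _ _ _ _ c1 d1) => // [n|]; [rewrite armR_int ?intr_nat|apply: linrec_armR].
- by apply: (Harm m.+2 _ _ _ _ _ c2 d2) => // [n|]; [rewrite armR_int ?intr_nat|apply: linrec_armR].
Qed.

(** * The solution on a cycle *)

Arguments farey : simpl never.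

Section CycleSolution.
Variables (m : nat) (eps : nat -> bool).
Local Notation a := (farey eps m.+1).1.
Local Notation b := (farey eps m.+1).2.
Local Notation s := (rises eps m.+1).
Local Notation r := (falls eps m.+1).
Hypotheses (s0 : (0 < s)%N) (r0 : (0 < r)%N).

Definition turn (u : vec) : vec := comb u.1 a u.2 b.
Definition unturn (u : vec) : vec := (cross u b, cross a u).
Definition vcol : nat -> vec := pext s turn (fcol eps m.+1).
Definition vrow : nat -> vec := pext r unturn (fun i => frow eps m.+1 (r - i)).
Definition ctile k n : rat :=
  cross (vcol (n + rises eps k)) (vrow (n + rises eps k + r - k)).

Let ab1 : cross a b = 1 := farey_cross eps m.+1.

Let turn_col : fcol eps m.+1 s = turn (fcol eps m.+1 0).
Proof. by rewrite fcol_last // fcol0; rewrite /turn /comb /= !mul1r !mul0r !addr0; case: (farey _ _).1. Qed.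

Let turn_row : frow eps m.+1 (r - r) = unturn (frow eps m.+1 (r - 0)).
Proof.
by rewrite subnn subn0 frow0 frow_last // /unturn ab1; congr pair; rewrite /cross; ring.
Qed.

(** The two maps are adjoint for the determinant. Moving a full turn from the row to the column is
    what identifies the two ends of the strip. *)
Lemma cross_unturn u w : cross u (unturn w) = cross (turn u) w.
Proof. by rewrite /cross /unturn /turn /cross /=; ring. Qed.

Lemma turn_cross u w : cross (turn u) (turn w) = cross u w.
Proof. by rewrite -[RHS]mulr1 -ab1 /cross /=; ring. Qed.

Lemma unturn_cross u w : cross (unturn u) (unturn w) = cross u w.
Proof. by rewrite -[RHS]mulr1 -ab1 /cross /=; rewrite /cross; ring. Qed.

Lemma vcol_cross i : cross (vcol i) (vcol i.+1) = 1.
Proof. by apply: pext_cross => // [|j]; [exact: turn_cross|exact: fcol_cross]. Qed.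

Lemma vrow_cross i : cross (vrow i) (vrow i.+1) = 1.
Proof.
apply: pext_cross => // [|j lt]; first exact: unturn_cross.
by rewrite -(subnSK lt) frow_cross //; lia.
Qed.

Lemma vcolD i : vcol (i + s) = turn (vcol i).
Proof. exact: pextD. Qed.

Lemma vrowD i : vrow (i + r) = unturn (vrow i).
Proof. exact: pextD. Qed.

Lemma strip_ctile : strip m eps ctile (fun n => ctile m (n + eps m)) (fun n => ctile 0 (n + ~~ eps m)).
Proof.
have h := rises_falls eps m.+1.
split=> [k le|k n le].
  have h' := rises_mono eps _ _ (leqW le); have h1 := rises_falls eps k.
  have h2 := falls_mono eps _ _ (leqW le).
  rewrite /ctile add0n /vcol /vrow !pext_small //; last by lia.
  rewrite fcol_at ?leqW //.
  have -> : (r - (rises eps k + r - k) = falls eps k)%N by lia.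
  by rewrite frow_at ?leqW // farey_cross.
have hk := rises_falls eps k; have hk' := falls_mono eps _ _ (leqW le).
rewrite {1 2}/ctile addSn; set c := (n + rises eps k)%N.
have -> : (c.+1 + r - k = (c + r - k).+1)%N by rewrite /c; lia.
rewrite plucker vcol_cross vrow_cross mulr1; congr (_ + _ * _).
  case: k le hk hk' @c => [|k] le hk hk' c.
    rewrite subn0 /c addn0 /ctile -addnA -/(rises eps m.+1) -addSn vrowD cross_unturn -vcolD.
    by congr cross; congr vrow; lia.
  rewrite /ctile -addnA -/(rises eps k.+1) -/c; congr cross; congr vrow.
  by rewrite /c; lia.
case: ltnP => lt.
  rewrite /ctile; have -> : (n + ~~ eps k + rises eps k.+1 = c.+1)%N by rewrite /c /=; case: (eps k) => /=; lia.
  by congr cross; congr vrow; rewrite /c; lia.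
have E : k = m by lia.
rewrite /ctile /= addn0 subn0 vrowD cross_unturn -vcolD /c E.
have e1' : (n + ~~ eps m + s = (n + rises eps m).+1)%N by rewrite /=; case: (eps m) => /=; lia.
by rewrite -e1'; congr cross; congr vrow; have := rises_falls eps m; rewrite /=; case: (eps m) => /=; lia.
Qed.

Lemma ctile_int k n : ctile k n \is a Num.int.
Proof.
have [/natvec_int na /natvec_int nb] := farey_nat eps m.+1.
apply: int_cross.
  apply: (pext_ind _ _ _ _ intvec 0) => // [u [u1 u2]|j /andP[_ lt]].
    exact: intvec_comb.
  by rewrite pext_small //; [apply/natvec_int/fcol_nat|exact: ltnW].
apply: (pext_ind _ _ _ _ intvec 0) => // [u iu|j /andP[_ lt]].
  by split; apply: int_cross.
by rewrite pext_small //; [apply/natvec_int/frow_nat|exact: ltnW].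
Qed.

Lemma linrec_vcol (p : bool) : linrec (fun n => if p then (vcol n).1 else (vcol n).2).
Proof.
have [na nb] := farey_nat eps m.+1.
have H : linrec (fun n => let u := vcol (n + 0) in if p then u.1 else u.2).
  apply: linrec_pext => //.
  - by move=> u; rewrite /turn /comb /=; congr pair; ring.
  - by apply: natvec_comb.
  - by apply: natvec_comb.
  by move=> j /andP[_ lt]; rewrite pext_small //; [exact: fcol_nat|exact: ltnW].
by apply: eq_linrec H => n; rewrite addn0.
Qed.

(** From index [r] on the rows lie in the second quadrant, by [frow_coord]. Once the first
    coordinate is negated, [unturn] has the coordinates of [a] and [b] as coefficients. *)
Lemma linrec_vrow (p : bool) :
  linrec (fun n => if p then - (vrow (n + r)).1 else (vrow (n + r)).2).
Proof.
have [[na1 na2] [nb1 nb2]] := farey_nat eps m.+1.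
apply: (@linrec_delay bool r
  (fun p n => if p then - (vrow (n + r)).1 else (vrow (n + r)).2)
  (fun p q => if p then if q then b.2 else b.1 else if q then a.2 else a.1)) => //.
- by case; case.
- move=> q n lt; have := frow_coord eps m.+1 (r - n)%N.
  have <- : vrow n = frow eps m.+1 (r - n) by rewrite /vrow pext_small // ltnW.
  by rewrite vrowD; case: q => -[].
move=> q n; rewrite big_bool /= vrowD.
by case: q => /=; rewrite /cross; ring.
Qed.

(** The shift by [k] brings the row index to at least [r]. *)
Lemma linrec_ctile k : linrec (fun n => ctile k (n + k)).
Proof.
pose i := (k + rises eps k)%N.
have H : linrec (fun n => (vcol (n + i)).1 * (vrow (n + rises eps k + r)).2
                        + (vcol (n + i)).2 * - (vrow (n + rises eps k + r)).1).
  apply: linrecD; apply: linrecM.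
  - exact: linrec_shift (linrec_vcol true).
  - exact: linrec_shift (linrec_vrow false).
  - exact: linrec_shift (linrec_vcol false).
  - exact: linrec_shift (linrec_vrow true).
apply: eq_linrec H => n; rewrite /ctile.
have -> : (n + k + rises eps k + r - k = n + rises eps k + r)%N by lia.
have -> : (n + k + rises eps k = n + i)%N by rewrite addnA.
by rewrite /cross; ring.
Qed.

End CycleSolution.

Lemma linrec_cycle m eps f lv rv (h : nat -> nat) : strip m eps f lv rv ->
  (forall k n, (k <= m)%N -> 0 < f k n) ->
  (forall n, lv n = f m (n + eps m)%N) -> (forall n, rv n = f 0%N (n + ~~ eps m)%N) ->
  (forall k, (k < m)%N -> if eps k then (h k < h k.+1)%N else (h k.+1 < h k)%N) ->
  (if eps m then (h m < h 0)%N else (h 0 < h m)%N) ->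
  forall k, (k <= m)%N -> linrec (f k).
Proof.
move=> [f0 Hf] Hp Hl Hr hk hm.
have s0 : (0 < rises eps m.+1)%N.
  rewrite lt0n; apply/eqP => E.
  have E' k : (k <= m)%N -> eps k = false.
    by move=> le; have := rises_mono eps k.+1 m.+1 le; rewrite E /=; case: (eps k).
  have H k : (k <= m)%N -> (h k <= h 0)%N.
    by elim: k => // k IH lt; move: (hk k lt) (IH (ltnW lt)); rewrite (E' _ (ltnW lt)); lia.
  by move: hm (H m (leqnn m)); rewrite E' //; lia.
have r0 : (0 < falls eps m.+1)%N.
  rewrite lt0n; apply/eqP => E.
  have E' k : (k <= m)%N -> eps k = true.
    by move=> le; have := falls_mono eps k.+1 m.+1 le; rewrite E /=; case: (eps k).
  have H k : (k <= m)%N -> (h 0 <= h k)%N.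
    by elim: k => // k IH lt; move: (hk k lt) (IH (ltnW lt)); rewrite (E' _ (ltnW lt)); lia.
  by move: hm (H m (leqnn m)); rewrite E' //; lia.
have [g0 Hg] := strip_ctile m eps s0 r0.
have E n : forall k, (k <= m)%N -> f k n = ctile m eps k n.
  elim: n => [|n IHn] k; first by move=> le; rewrite f0 ?g0.
  have [t] := ubnP (h k); elim: t k => // t IHt k lt le.
  have nz : f k n != 0 by rewrite gt_eqF ?Hp.
  apply: (mulfI nz); rewrite Hf // (IHn k) // Hg //.
  have IH j (e : bool) : (j <= m)%N -> (e -> (h j < h k)%N) -> f j (n + e)%N = ctile m eps j (n + e)%N.
    move=> lj; case: e => /= Hj; last by rewrite addn0 IHn.
    by rewrite addn1 IHt //; have := Hj isT; lia.
  congr (_ + _ * _).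
    case: k lt le {nz} IH => [|k] lt le IH.
      by rewrite Hl; apply: IH => //; move: hm; case: (eps m).
    by apply: IH => [|ek]; [exact: ltnW|move: (hk k le); rewrite ek].
  case: ltnP => lt'.
    by apply: IH => //; move: (hk k lt'); case: (eps k).
  have E' : k = m by lia.
  by rewrite Hr; apply: IH => //; rewrite E'; move: hm; case: (eps m).
move=> k le; apply: (linrec_prefix k) => [n _|].
  by apply: pos_int_nat; [exact: Hp|rewrite E // ctile_int].
by apply: eq_linrec (linrec_ctile m eps s0 r0 k) => n; rewrite E.
Qed.

(** * From Cartan matrices to lists of bonds *)

Definition bond (b : nat -> nat -> rat) (o : nat -> nat -> bool) j n
    (e : nat * nat * (int * int)) : rat :=
  (if e.1.1 == j then b e.1.2 (n + o e.1.2 e.1.1)%N ^+ `|e.2.2|%N else 1) *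
  (if e.1.2 == j then b e.1.1 (n + o e.1.1 e.1.2)%N ^+ `|e.2.1|%N else 1).

Definition bond_frise d (E : seq (nat * nat * (int * int)))
    (o : nat -> nat -> bool) (b : nat -> nat -> rat) : Prop :=
  [/\ forall j n, (j < d)%N -> 0 < b j n, forall j, (j < d)%N -> b j 0%N = 1,
      forall e, e \in E -> o e.1.2 e.1.1 = ~~ o e.1.1 e.1.2,
      forall j n, (j < d)%N -> b j n * b j n.+1 = 1 + \prod_(e <- E) bond b o j n e
    & exists h : nat -> nat, forall e, e \in E ->
        if o e.1.1 e.1.2 then (h e.1.1 < h e.1.2)%N else (h e.1.2 < h e.1.1)%N].

Definition good_bonds d (E : seq (nat * nat * (int * int))) :=
  all (fun e => [&& e.1.1 != e.1.2, (e.1.1 < d)%N, (e.1.2 < d)%N, e.2.1 < 0 & e.2.2 < 0]) E.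

Definition weight i j (e : nat * nat * (int * int)) : nat :=
  ((if (e.1.1 == i) && (e.1.2 == j) then `|e.2.1| else 0)
   + (if (e.1.1 == j) && (e.1.2 == i) then `|e.2.2| else 0))%N.

(** All contributions are nonpositive, so absolute values add without cancellation. *)
Lemma absz_gcm d E i j : good_bonds d E -> i != j ->
  `|gcm E i j|%N = (\sum_(e <- E) weight i j e)%N.
Proof.
move=> gE nij; rewrite /gcm (negbTE nij).
suff [] : (\sum_(e <- E) ((if (e.1.1 == i) && (e.1.2 == j) then e.2.1 else 0)
   + (if (e.1.1 == j) && (e.1.2 == i) then e.2.2 else 0)) <= 0 :> int) /\
   `|(\sum_(e <- E) ((if (e.1.1 == i) && (e.1.2 == j) then e.2.1 else 0)
   + (if (e.1.1 == j) && (e.1.2 == i) then e.2.2 else 0)) : int)|%N = (\sum_(e <- E) weight i j e)%N by [].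
elim: E gE => [|e E IH] /= ; first by rewrite !big_nil.
move=> /andP[/and5P[_ _ _ l1 l2] /IH[h1 h2]]; rewrite !big_cons -h2 /weight.
move: (\sum_(i0 <- E) _) h1 {h2} => S h1.
move: e.2.1 e.2.2 l1 l2 => x y l1 l2.
by case: ifP => _; case: ifP => _; split; lia.
Qed.

Section Acyclic.
Variables (d : nat) (C : 'M[int]_d) (o : rel 'I_d).
Hypotheses (Co : acyclic_orientation C o).

Definition depth (i : 'I_d) : nat := #|[set k | connect o k i]|.

Lemma depth_lt i j : o i j -> (depth i < depth j)%N.
Proof.
case: Co => _ _ _ Hac oij; apply: proper_card; apply/properP; split.
  by apply/subsetP => k; rewrite !inE => h; apply: connect_trans h (connect1 oij).
by exists j; rewrite inE ?connect0 //; apply: Hac.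
Qed.

Lemma frise_gt0 a : is_frise C o a -> forall j n, 0 < a j n.
Proof.
move=> [a0 Ha] j n; elim: n j => [|n IHn] j; first by rewrite a0.
have [t] := ubnP (depth j); elim: t j => // t IHt j lt.
have /eqP : a j n * a j n.+1 = a j n * a j n.+1 by [].
rewrite {2}Ha => /eqP E.
have : 0 < a j n * a j n.+1.
  rewrite E addr_gt0 // mulr_gt0 //; apply: prodr_gt0 => i oi; apply: exprn_gt0 => //.
  by apply: IHt; have := depth_lt _ _ oi; lia.
by rewrite pmulr_rgt0.
Qed.

Lemma frise_prod a j n :
  (\prod_(i | o j i) a i n ^+ `|C i j|%N) * (\prod_(i | o i j) a i n.+1 ^+ `|C i j|%N)
  = \prod_i (if i != j then a i (n + o i j)%N ^+ `|C i j|%N else 1) :> rat.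
Proof.
case: Co => H1 H2 H3 _.
rewrite (big_mkcond (o j)) (big_mkcond (fun i => o i j)) -big_split /=; apply: eq_bigr => i _.
case: eqP => [->|/eqP ne] /=.
  by case E: (o j j); [have := H1 _ _ E; rewrite /cedge eqxx|rewrite mulr1].
case E: (o i j).
  by rewrite (negbTE (H3 _ _ E)) mul1r addn1.
rewrite mulr1 addn0; case E': (o j i) => //.
case: (eqVneq (C i j) 0) => [->//|nz]; by have := H2 i j; rewrite /cedge ne nz E E' => /(_ isT).
Qed.

End Acyclic.

Lemma prod_weight d (s : 'S_d) (F : 'I_d -> rat) (e : nat * nat * (int * int)) (i0 i1 j : 'I_d) :
  e.1.1 = s i0 -> e.1.2 = s i1 -> i0 != i1 ->
  \prod_i (if i != j then F i ^+ weight (s i) (s j) e else 1) =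
  (if i0 == j then F i1 ^+ `|e.2.2|%N else 1) * (if i1 == j then F i0 ^+ `|e.2.1|%N else 1).
Proof.
move=> h0 h1 ne.
have sE k l : ((s k : nat) == s l) = (k == l) by rewrite (inj_eq val_inj) (inj_eq perm_inj).
have pick1 k c : \prod_i (if i == k then F i ^+ c else 1) = F k ^+ c.
  by rewrite -big_mkcond big_pred1_eq.
rewrite mulrC.
transitivity (\prod_i ((if (i == i0) then F i ^+ (if i1 == j then `|e.2.1|%N else 0%N) else 1) *
                       (if (i == i1) then F i ^+ (if i0 == j then `|e.2.2|%N else 0%N) else 1))).
  apply: eq_bigr => i _; rewrite /weight h0 h1 !sE exprD.
  case: (eqVneq i j) => [->|nij] /=.
    rewrite (eq_sym i1 j) (eq_sym i0 j); case: (eqVneq j i0) => [->|_].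
      by rewrite (negbTE ne) mulr1.
    by rewrite if_same mul1r.
  rewrite (eq_sym i0 i) (eq_sym i1 i).
  by case: (i == i0); case: (i1 == j); case: (i0 == j); case: (i == i1).
rewrite big_split /= !pick1; congr (_ * _); by case: ifP.
Qed.

Lemma frise_bonds d (C : 'M[int]_d) o a E :
  acyclic_orientation C o -> is_frise C o a -> cartan_of_type C (gcm E) -> good_bonds d E ->
  exists (o' : nat -> nat -> bool) (b : nat -> nat -> rat), bond_frise d E o' b /\
    ((forall k, (k < d)%N -> linrec (b k)) -> forall j, N_rational (a j)).
Proof.
move=> Co Fa [s Cs] gE.
(* The vertex numbered [k] by [s]. Numbers from [d] on get default values, which no bond meets since
   its ends are below [d]. *)
pose vx (k : nat) : option 'I_d := omap (s^-1)%g (insub k).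
have vxE (j : 'I_d) : vx (s j) = Some j by rewrite /vx valK /= permK.
have vxs k : (k < d)%N -> exists j : 'I_d, k = s j.
  by move=> lt; exists ((s^-1)%g (Ordinal lt)); rewrite permKV.
pose b k n := if vx k is Some i then a i n else 1.
pose o' k l := if vx k is Some i then if vx l is Some j then o i j else false else false.
pose h k := if vx k is Some i then depth d o i else 0%N.
have bE j n : b (s j) n = a j n by rewrite /b vxE.
have oE i j : o' (s i) (s j) = o i j by rewrite /o' !vxE.
have hE j : h (s j) = depth d o j by rewrite /h vxE.
have ends e : e \in E -> exists i0 i1 : 'I_d, [/\ e.1.1 = s i0, e.1.2 = s i1, i0 != i1 & o i1 i0 = ~~ o i0 i1].
  move=> eE; have /and5P[ne l1 l2 n1 n2] := allP gE _ eE.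
  have [i0 E0] := vxs _ l1; have [i1 E1] := vxs _ l2; exists i0, i1.
  have ne' : i0 != i1 by apply: contraNneq ne => E'; rewrite E0 E1 E'.
  split=> //; case: Co => H1 H2 H3 _.
  have : cedge C i0 i1.
    rewrite /cedge ne' /= Cs -absz_eq0 (absz_gcm d) //; last by rewrite (inj_eq val_inj) (inj_eq perm_inj).
    rewrite (big_rem e) //= addn_eq0 negb_and /weight E0 E1 !eqxx /= addn_eq0 negb_and absz_eq0.
    by rewrite lt_eqF.
  move=> /H2; case X: (o i0 i1) => /=; last by [].
  by move=> _; apply/negbTE/H3.
exists o', b; split; last first.
  by move=> Hb j; apply: linrec_N_rational; apply: eq_linrec (Hb (s j) (ltn_ord _)) => n; rewrite bE.
have ap := frise_gt0 _ _ _ Co _ Fa.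
split.
- by move=> j n /vxs[i ->]; rewrite bE.
- by move=> j /vxs[i ->]; rewrite bE; case: Fa.
- by move=> e /ends[i0 [i1 [-> -> _ H]]]; rewrite !oE.
- move=> _ n /vxs[j ->]; rewrite !bE; case: Fa => _ ->; rewrite (frise_prod _ _ _ Co); congr (1 + _).
  transitivity (\prod_i \prod_(e <- E) (if i != j then a i (n + o i j)%N ^+ weight (s i) (s j) e else 1)).
    apply: eq_bigr => i _; case: ifP => ne; last by rewrite big1.
    rewrite Cs (absz_gcm d) //; last by rewrite (inj_eq val_inj) (inj_eq perm_inj).
    by rewrite prodrXr.
  rewrite exchange_big /=; apply: eq_big_seq => e /ends[i0 [i1 [h0 h1 ne _]]].
  rewrite (prod_weight _ _ (fun i => a i (n + o i j)%N) _ _ _ _ h0 h1 ne) /bond h0 h1 !bE !oE.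
  rewrite !(inj_eq val_inj) !(inj_eq perm_inj).
  by case: (eqVneq i0 j) => [<-|_]; case: (eqVneq i1 _) => [E1|_] //; rewrite -E1.
- exists h => e /ends[i0 [i1 [-> -> _ H]]]; rewrite !hE oE.
  by case X: (o i0 i1); apply: depth_lt Co _ _ _ => //; rewrite H X.
Qed.

(** * Double bonds: unfolding *)

Lemma strip_join m eps f lv rv rv' g em : strip m eps f lv rv' ->
  (forall n, rv' n = g (n + ~~ em)%N) -> g 0%N = 1 ->
  (forall n, g n * g n.+1 = 1 + f m (n + em)%N * rv n) ->
  strip m.+1 (fun k => if (k < m)%N then eps k else em)
    (fun k => if (k <= m)%N then f k else g) lv rv.
Proof.
move=> [f0 Hf] Hr g0 Hg; split=> [k le|k n le]; first by case: ifP => // /f0.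
case: (leqP k m) => km /=.
  rewrite Hf //; congr (_ + _ * _).
    by case: k km {le} => // k km; rewrite (ltnW km) km.
  by rewrite (leq_ltn_trans km (ltnSn m)); case: ltnP => // _; rewrite Hr.
have E : k = m.+1 by lia.
by rewrite E Hg leqnn !ltnn.
Qed.

(* Unfolding the strip across the end vertex g makes g an interior vertex. *)
Definition refl_end (fm rv : nat -> rat) (em : bool) (g : nat -> rat) : Prop :=
  [/\ forall n, rv n = g (n + ~~ em)%N, g 0%N = 1, forall n, 0 < g n
    & forall n, g n * g n.+1 = 1 + fm (n + em)%N ^+ 2].

Section EndCombinations.
Variables (m : nat) (eps : nat -> bool) (f : nat -> nat -> rat) (lv rv : nat -> rat).
Hypotheses (Hs : strip m eps f lv rv) (Hp : forall k n, (k <= m)%N -> 0 < f k n).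

Lemma linrec_free_free : lv =1 (fun=> 1) -> rv =1 (fun=> 1) ->
  forall k, (k <= m)%N -> linrec (f k).
Proof.
move=> Hl Hr k le.
(* Both constant factors become extra vertices; the reversal turns the right end into a left one. *)
have H := strip_extend _ _ _ _ _ (strip_rev _ _ _ _ _ (strip_extend _ _ _ _ _ Hs Hl)) Hr.
suff : linrec (f (m.+1 - (m - k)).-1).
  by congr (linrec (f _)); lia.
have := linrec_strip_const_const _ _ _ _ _ H _ (frefl _) (frefl _) (m - k).+1.
rewrite (_ : m.+1 - (m - k) = (m.+1 - (m - k)).-1.+1)%N; last by lia.
apply; last by lia.
move=> [|j] n lj; first by [].
by case E: (m.+1 - j)%N => [|i] //; apply: Hp; lia.
Qed.

Lemma linrec_free_fork q1 q2 z1 z2 : lv =1 (fun=> 1) -> fork (f m) rv q1 q2 z1 z2 ->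
  (forall n, 0 < z1 n) -> (forall n, 0 < z2 n) ->
  [/\ forall k, (k <= m)%N -> linrec (f k), linrec z1 & linrec z2].
Proof.
move=> Hl Hr p1 p2.
have [|H1 H2 H3] := linrec_strip_const_fork _ _ _ _ _ q1 q2 z1 z2
  (strip_extend _ _ _ _ _ Hs Hl) _ (frefl _) Hr p1 p2.
  by case=> [|k] n le //; apply: Hp.
by split=> // k le; apply: (H1 k.+1).
Qed.

End EndCombinations.

Section ReflRight.
Variables (m : nat) (eps : nat -> bool) (f : nat -> nat -> rat) (lv rv : nat -> rat).
Hypotheses (Hs : strip m eps f lv rv) (Hp : forall k n, (k <= m)%N -> 0 < f k n).
Variables (em : bool) (g : nat -> rat).
Hypothesis Hg : refl_end (f m) rv em g.

Lemma strip_refl : strip m.+1.*2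
  (fun k => if (k < m.+1)%N then if (k < m)%N then eps k else em
            else ~~ (if (m.+1.*2 - k.+1 < m)%N then eps (m.+1.*2 - k.+1)%N else em))
  (fun k => if (mirror m.+1 k <= m)%N then f (mirror m.+1 k) else g) lv lv.
Proof.
case: Hg => h1 h2 h3 h4.
apply: (strip_unfold m.+1 _ (fun k => if (k <= m)%N then f k else g)) (fun n => f m (n + em)%N) _ _ _ => //.
  by apply: strip_join Hs h1 h2 _ => n; rewrite h4 expr2.
by move=> n; rewrite /= leqnn ltnn.
Qed.

Lemma strip_refl_gt0 k n : 0 < (if (mirror m.+1 k <= m)%N then f (mirror m.+1 k) else g) n.
Proof. by case: ifP => [/Hp //|_]; case: Hg. Qed.

Lemma linrec_refl_half :
  (forall k, (k <= m.+1.*2)%N ->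
     linrec (if (mirror m.+1 k <= m)%N then f (mirror m.+1 k) else g)) ->
  (forall k, (k <= m)%N -> linrec (f k)) /\ linrec g.
Proof.
move=> H; split=> [k le|].
  by have := H k; rewrite /mirror leqW // le; apply; lia.
by have := H m.+1; rewrite /mirror leqnn ltnn; apply; lia.
Qed.

Lemma linrec_free_refl : lv =1 (fun=> 1) ->
  (forall k, (k <= m)%N -> linrec (f k)) /\ linrec g.
Proof.
move=> Hl; apply: linrec_refl_half.
exact: (linrec_free_free _ _ _ _ _ strip_refl (fun k n _ => strip_refl_gt0 k n) Hl Hl).
Qed.

(** The mirror image of the fork stands at the far end of the unfolded chain. *)
Lemma linrec_fork_refl o1 o2 x1 x2 : fork (f 0%N) lv o1 o2 x1 x2 ->
  (forall n, 0 < x1 n) -> (forall n, 0 < x2 n) ->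
  [/\ forall k, (k <= m)%N -> linrec (f k), linrec g, linrec x1 & linrec x2].
Proof.
move=> Fl p1 p2; have Fr : fork (if (mirror m.+1 m.+1.*2 <= m)%N
    then f (mirror m.+1 m.+1.*2) else g) lv o1 o2 x1 x2.
  have -> : mirror m.+1 m.+1.*2 = 0%N by rewrite /mirror ifF ?subnn //; lia.
  exact: Fl.
have [H h1 h2 _ _] := linrec_strip_fork_fork _ _ _ _ _ o1 o2 x1 x2 o1 o2 x1 x2 strip_refl
  (fun k n _ => strip_refl_gt0 k n) Fl p1 p2 Fr p1 p2.
by have [] := linrec_refl_half H.
Qed.
End ReflRight.

Lemma refl_end_rank m (eps : nat -> bool) (h : nat -> nat) :
  (forall k, (k < m.+1)%N -> if eps k then (h k < h k.+1)%N else (h k.+1 < h k)%N) ->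
  forall k, (k < m.+1.*2)%N ->
  if (if (k < m.+1)%N then eps k else ~~ eps (m.+1.*2 - k.+1)%N)
  then (h (mirror m.+1 k) < h (mirror m.+1 k.+1))%N
  else (h (mirror m.+1 k.+1) < h (mirror m.+1 k))%N.
Proof.
move=> H k lt; case: (ltnP k m.+1) => km.
  by have := H k km; rewrite /mirror km (ltnW km).
have := H (m.+1.*2 - k.+1)%N; rewrite /mirror.
have -> : (k < m.+1)%N = false by lia.
have -> : ((m.+1.*2 - k.+1).+1 = m.+1.*2 - k)%N by lia.
have E : (if (k <= m.+1)%N then k else (m.+1.*2 - k)%N) = (m.+1.*2 - k)%N by case: ifP => // ?; lia.
by rewrite E => /(_ _); case: (eps _) => /=; apply; lia.
Qed.

Lemma eq_strip m eps f lv lv' rv rv' : lv =1 lv' -> rv =1 rv' ->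
  strip m eps f lv rv -> strip m eps f lv' rv'.
Proof.
move=> el er [h0 H]; split=> // k n le; rewrite H //; congr (_ + _ * _).
  by case: (k) => //.
by case: ifP.
Qed.

(* Reflecting at both ends unfolds the strip to a cycle. *)
Lemma linrec_mirror_cycle m eps f (h : nat -> nat) :
  strip m.+1 eps f (fun n => f 1%N (n + ~~ eps 0%N)%N) (fun n => f m (n + eps m)%N) ->
  (forall k n, (k <= m.+1)%N -> 0 < f k n) ->
  (forall k, (k < m.+1)%N -> if eps k then (h k < h k.+1)%N else (h k.+1 < h k)%N) ->
  forall k, (k <= m.+1)%N -> linrec (f k).
Proof.
move=> Hs Hp hh.
have mir k : (k <= m.+1.*2)%N -> (mirror m.+1 k <= m.+1)%N by rewrite /mirror; case: ifP; lia.
have S := strip_unfold m.+1 _ _ _ _ isT Hs (fun=> erefl).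
have hr := refl_end_rank m eps h hh.
rewrite doubleS in S mir hr; move/strip_cut: S => S k le.
have -> : f k = f (mirror m.+1 k) by rewrite /mirror le.
have m2 : mirror m.+1 m.*2.+2 = 0%N by rewrite /mirror ifF -?doubleS ?subnn //; lia.
have m1 : mirror m.+1 m.*2.+1 = 1%N.
  by rewrite /mirror; case: ifP => [|_]; [lia|rewrite doubleS subSS subSnn].
apply: (linrec_cycle _ _ _ _ _ (fun k => h (mirror m.+1 k)) S) => [j n lj|n|n|j lj||].
- by apply/Hp/mir/leqW.
- rewrite m1; case: ltnP => lt; last by rewrite subnn.
  by exfalso; lia.
- by rewrite m2 /mirror.
- by apply: hr; lia.
- by have := hr m.*2.+1 (ltnSn _); rewrite m2.
by lia.
Qed.

Lemma linrec_refl_refl m eps f lv rv em g e0 g0 (h : nat -> nat) (hg hg0 : nat) :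
  strip m eps f lv rv -> (forall k n, (k <= m)%N -> 0 < f k n) ->
  refl_end (f m) rv em g -> refl_end (f 0%N) lv e0 g0 ->
  (forall k, (k < m)%N -> if eps k then (h k < h k.+1)%N else (h k.+1 < h k)%N) ->
  (if em then (h m < hg)%N else (hg < h m)%N) ->
  (if e0 then (h 0 < hg0)%N else (hg0 < h 0)%N) ->
  [/\ forall k, (k <= m)%N -> linrec (f k), linrec g & linrec g0].
Proof.
move=> Hs Hp [r1 r2 r3 r4] [l1 l2 l3 l4] hh hm h0.
have Hi n : g n * g n.+1 = 1 + f m (n + em)%N * f m (n + em)%N by rewrite r4 expr2.
have S1 := strip_join _ _ _ _ (fun n => f m (n + em)%N) _ g em Hs r1 r2 Hi.
have S2 := strip_rev _ _ _ _ _ S1.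
have Hj n : g0 n * g0 n.+1 = 1 + (fun k => if (m.+1 - k <= m)%N then f (m.+1 - k)%N else g) m.+1 (n + e0)%N
    * f 0%N (n + e0)%N by rewrite l4 expr2 subnn.
have S3 := strip_join _ _ _ _ (fun n => f 0%N (n + e0)%N) _ g0 e0 S2 l1 l2 Hj.
(* The ranks of the two reflecting vertices extend [h], so that the unfolded cycle is again
   acyclic. *)
pose h1 k := if (k <= m)%N then h k else hg.
pose h2 k := if (k <= m.+1)%N then h1 (m.+1 - k)%N else hg0.
have S4 := eq_strip _ _ _ _ _ _ _ _ _ S3.
have H := linrec_mirror_cycle m.+1 _ _ h2 (S4 _ _ _ _) _ _.
have H' : forall k, (k <= m.+2)%N -> linrec
   (if (k <= m.+1)%N then if (m.+1 - k <= m)%N then f (m.+1 - k)%N else g else g0).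
  apply: H => [n|n|k n le|k lt].
  - by rewrite /= subSS subn0 leqnn ltnn /= negbK.
  - by rewrite /= leqnn ltnn subnn.
  - by case: ifP => _ //; case: ifP => // /Hp.
  have le : (k <= m.+1)%N by lia.
  rewrite /h2 /h1 le; case: (ltnP k m.+1) => km; last first.
    have -> : k = m.+1 by lia.
    by rewrite subnn.
  rewrite subSS leq_subr; case: (ltnP (m - k) m) => k0.
    have E : (m.+1 - k = (m - k).+1)%N by lia.
    by rewrite E k0; have := hh _ k0; case: (eps _).
  have -> : k = 0%N by lia.
  by rewrite !subn0 ltnn; case: (em) hm.
split=> [k le||].
- have := H' (m.+1 - k)%N; have -> : (m.+1 - (m.+1 - k) = k)%N by lia.
  by rewrite leq_subr le; apply; lia.
- by have := H' 0%N isT; rewrite /= ltnn.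
by have := H' m.+2 (leqnn _); rewrite ltnn.
Qed.

(** * The infinite series *)

Lemma chain_prod b o c len j n : \prod_(e <- chain c len) bond b o j n e =
  (if (c < j <= c + len)%N then b j.-1 (n + o j.-1 j)%N else 1) *
  (if (c <= j < c + len)%N then b j.+1 (n + o j.+1 j)%N else 1).
Proof.
elim: len => [|len IH]; first by rewrite big_nil !ifF ?mulr1 //; lia.
rewrite /chain -addn1 iotaD map_cat big_cat /= big_seq1 -/(chain c len) IH /bond /= !expr1.
case: (eqVneq (c + len)%N j) => [<-|n1].
  have -> : (c + len).+1 == (c + len)%N = false by lia.
  rewrite mulr1 ltnn andbF mulr1; congr (_ * _).
    by congr (if _ then _ else _); lia.
  by rewrite ifT //; lia.
rewrite mul1r; case: (eqVneq (c + len).+1 j) => [<-|n2].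
  have -> : (c < (c + len).+1 <= c + len)%N = false by lia.
  have -> : (c <= (c + len).+1 < c + len)%N = false by lia.
  have -> : (c < (c + len).+1 <= c + (len + 1))%N by lia.
  have -> : (c <= (c + len).+1 < c + (len + 1))%N = false by lia.
  by rewrite !mul1r mulr1.
by rewrite mulr1; congr (_ * _); congr (if _ then _ else _); lia.
Qed.

(** A double bond is a fork with two equal arms if the inner vertex sees the outer one squared, and
    a reflection if the outer vertex sees the inner one squared. The first kind is [Double true] on
    the left and [Double false] on the right. *)
Inductive chain_end := Free | Double of bool | Fork.

Definition end_size (l : chain_end) : nat :=
  match l with Free => 0 | Double _ => 1 | Fork => 2 end.
Definition left_bonds (l : chain_end) : seq (nat * nat * (int * int)) :=
  match l with Free => [::] | Double p => [:: (0%N, 1%N, dbl p)] | Fork => [:: sbond 0 2; sbond 1 2] end.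
Definition right_bonds (t : nat) (r : chain_end) : seq (nat * nat * (int * int)) :=
  match r with Free => [::] | Double q => [:: (t, t.+1, dbl q)] | Fork => [:: sbond t t.+1; sbond t t.+2] end.

Section ChainEnds.
Variables (d m : nat) (l r : chain_end) (E : seq (nat * nat * (int * int))).
Variables (o : nat -> nat -> bool) (b : nat -> nat -> rat).
Local Notation c := (end_size l).
Local Notation t := (c + m)%N.
Hypotheses (Hb : bond_frise d E o b) (dE : d = (t + end_size r).+1).
Hypothesis HE : perm_eq E (chain c m ++ left_bonds l ++ right_bonds t r).

Let f k := b (c + k)%N.
Let eps k := o (c + k)%N (c + k).+1.
Let lv n := \prod_(e <- left_bonds l) bond b o c n e.
Let rv n := \prod_(e <- right_bonds t r) bond b o t n e.

Let bp j n : (j < d)%N -> 0 < b j n. Proof. by case: Hb => h _ _ _ _; apply: h. Qed.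
Let b0 j : (j < d)%N -> b j 0%N = 1. Proof. by case: Hb => _ h _ _ _; apply: h. Qed.

Let beq j n : (j < d)%N -> b j n * b j n.+1 = 1 +
  (\prod_(e <- chain c m) bond b o j n e) *
  ((\prod_(e <- left_bonds l) bond b o j n e) * (\prod_(e <- right_bonds t r) bond b o j n e)).
Proof. by case: Hb => _ _ _ h _ lt; rewrite h // (perm_big _ HE) /= !big_cat. Qed.

Let osym e : e \in chain c m ++ left_bonds l ++ right_bonds t r -> o e.1.2 e.1.1 = ~~ o e.1.1 e.1.2.
Proof. by rewrite -(perm_mem HE); case: Hb => _ _ h _ _; apply: h. Qed.

Let left_out j n : (c < j)%N -> \prod_(e <- left_bonds l) bond b o j n e = 1.
Proof.
case: l => [|p|] /= lt; rewrite ?big_nil // !big_cons big_nil /bond /= !ifF ?mulr1 //; lia.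
Qed.

Let right_out j n : (j < t)%N -> \prod_(e <- right_bonds t r) bond b o j n e = 1.
Proof.
case: r => [|p|] /= lt; rewrite ?big_nil // !big_cons big_nil /bond /= !ifF ?mulr1 //; lia.
Qed.

Let chain_sym k : (k < m)%N -> o (c + k).+1 (c + k)%N = ~~ eps k.
Proof.
move=> lt; apply: (osym (sbond (c + k) (c + k).+1)); rewrite mem_cat; apply/orP; left.
by apply/mapP; exists (c + k)%N => //; rewrite mem_iota; lia.
Qed.

Let chain_mem k : (k <= m)%N -> (c + k < d)%N. Proof. by move=> le; rewrite dE; lia. Qed.

Lemma ends_strip : strip m eps f lv rv.
Proof.
split=> [k le|k n le]; first by rewrite /f b0 ?chain_mem.
rewrite /f beq ?chain_mem // chain_prod mulrACA; congr (_ + _ * _).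
  case: k le => [|k] le.
    by rewrite addn0 ltnn /= mul1r.
  rewrite ifT; last by lia.
  by rewrite left_out ?mulr1 ?addnS //; lia.
case: (ltnP k m) => lt.
  rewrite ifT; last by lia.
  rewrite right_out ?mulr1; last by lia.
  by rewrite chain_sym // /f addnS.
rewrite ifF; last by lia.
have -> : k = m by lia.
by rewrite mul1r.
Qed.

Lemma ends_gt0 k n : (k <= m)%N -> 0 < f k n.
Proof. by move=> le; apply/bp/chain_mem. Qed.

Let outside j n : (j < d)%N -> (j < c)%N || (t < j)%N -> b j n * b j n.+1 = 1 +
  (\prod_(e <- left_bonds l) bond b o j n e) * (\prod_(e <- right_bonds t r) bond b o j n e).
Proof. by move=> lt h; rewrite beq // chain_prod !ifF ?mul1r //; lia. Qed.

Lemma left_end : (l = Free /\ lv =1 (fun=> 1)) \/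
  (exists o1 o2 x1 x2, [/\ l <> Free, fork (f 0%N) lv o1 o2 x1 x2, forall n, 0 < x1 n, forall n, 0 < x2 n
     & linrec x1 -> linrec x2 -> forall k, (k < c)%N -> linrec (b k)]) \/
  [/\ l = Double false, refl_end (f 0%N) lv (o 1%N 0%N) (b 0%N) & o 1%N 0%N = ~~ o 0%N 1%N].
Proof.
case: l dE beq b0 bp left_out right_out outside osym @f @lv => [|[]|] /= dE' beq' b0' bp' lo ro out os.
- by left; split=> // n; rewrite big_nil.
- right; left; exists (o 0%N 1%N), (o 0%N 1%N), (b 0%N), (b 0%N).
  have oE : o 1%N 0%N = ~~ o 0%N 1%N by apply: (os (0%N, 1%N, dbl true)); rewrite mem_cat inE eqxx orbT.
  have A : arm (b 1%N) (o 0%N 1%N) (b 0%N).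
    split=> [|n]; first by rewrite b0' // dE'.
    by rewrite out ?dE' // ro ?mulr1 // big_seq1 /bond /= mulr1 expr1 oE.
  split=> // [|n|n|_ H [|k] //]; [|by apply: bp'; rewrite dE'..].
  by split=> // n; rewrite big_seq1 /bond /= mul1r expr2.
- right; right.
  have oE : o 1%N 0%N = ~~ o 0%N 1%N by apply: (os (0%N, 1%N, dbl false)); rewrite mem_cat inE eqxx orbT.
  split=> //; split=> [n||n|n]; [|by rewrite b0' // dE'|by apply: bp'; rewrite dE'|].
    by rewrite big_seq1 /bond /= mul1r expr1 oE negbK.
  by rewrite out ?dE' // ro ?mulr1 // big_seq1 /bond /= mulr1.
right; left; exists (o 0%N 2%N), (o 1%N 2%N), (b 0%N), (b 1%N).
have o0 : o 2%N 0%N = ~~ o 0%N 2%N by apply: (os (sbond 0 2)); rewrite mem_cat inE eqxx orbT.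
have o1 : o 2%N 1%N = ~~ o 1%N 2%N by apply: (os (sbond 1 2)); rewrite mem_cat !inE eqxx !orbT.
split=> // [|n|n|h0 h1 [|[|k]] //]; [|by apply: bp'; rewrite dE'..].
split=> [||n].
- split=> [|n]; first by rewrite b0' // dE'.
  by rewrite out ?dE' // ro ?mulr1 // !big_cons big_nil /bond /= !mulr1 expr1 o0.
- split=> [|n]; first by rewrite b0' // dE'.
  by rewrite out ?dE' // ro ?mulr1 // !big_cons big_nil /bond /= !mulr1 mul1r expr1 o1.
by rewrite !big_cons big_nil /bond /= !expr1 !mul1r mulr1.
Qed.

Lemma right_end : (r = Free /\ rv =1 (fun=> 1)) \/
  (exists o1 o2 x1 x2, [/\ fork (f m) rv o1 o2 x1 x2, forall n, 0 < x1 n, forall n, 0 < x2 n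
     & linrec x1 -> linrec x2 -> forall k, (t < k < d)%N -> linrec (b k)]) \/
  [/\ r = Double true, refl_end (f m) rv (o t t.+1) (b t.+1) & o t.+1 t = ~~ o t t.+1].
Proof.
have n1 : (t.+1 == t) = false by lia.
have n2 : (t.+2 == t) = false by lia.
have n1' : (t == t.+1) = false by lia.
have n2' : (t == t.+2) = false by lia.
have n3 : (t.+1 == t.+2) = false by lia.
have n3' : (t.+2 == t.+1) = false by lia.
have nE := (eqxx, n1, n2, n1', n2', n3, n3').
have lo1 n : \prod_(e <- left_bonds l) bond b o t.+1 n e = 1 by apply: left_out; lia.
have lo2 n : \prod_(e <- left_bonds l) bond b o t.+2 n e = 1 by apply: left_out; lia.
case: r dE beq b0 bp right_out outside osym @rv => [|[]|] /= dE' beq' b0' bp' ro out os.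
- by left; split=> // n; rewrite big_nil.
- right; right.
  have oE : o t.+1 t = ~~ o t t.+1 by apply: (os (t, t.+1, dbl true)); rewrite !mem_cat inE eqxx !orbT.
  have d1 : (t.+1 < d)%N by rewrite dE'; lia.
  split=> //; split=> [n||n|n]; rewrite ?b0' ?bp' //.
    by rewrite big_seq1 /bond /= !nE mulr1 expr1 oE.
  by rewrite out ?ltnSn ?orbT // lo1 mul1r big_seq1 /bond /= !nE mul1r.
- right; left; exists (o t.+1 t), (o t.+1 t), (b t.+1), (b t.+1).
  have oE : o t.+1 t = ~~ o t t.+1 by apply: (os (t, t.+1, dbl false)); rewrite !mem_cat inE eqxx !orbT.
  have d1 : (t.+1 < d)%N by rewrite dE'; lia.
  have A : arm (f m) (o t.+1 t) (b t.+1).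
    split=> [|n]; first by rewrite b0'.
    by rewrite out ?ltnSn ?orbT // lo1 mul1r big_seq1 /bond /= !nE mul1r expr1 oE negbK.
  split=> [|n|n|h _ k]; rewrite ?bp' //.
    by split=> // n; rewrite big_seq1 /bond /= !nE mulr1 expr2.
  by move=> H; have -> : k = t.+1 by lia.
right; left; exists (o t.+1 t), (o t.+2 t), (b t.+1), (b t.+2).
have oE1 : o t.+1 t = ~~ o t t.+1 by apply: (os (sbond t t.+1)); rewrite !mem_cat inE eqxx !orbT.
have oE2 : o t.+2 t = ~~ o t t.+2 by apply: (os (sbond t t.+2)); rewrite !mem_cat !inE eqxx !orbT.
have d1 : (t.+1 < d)%N by rewrite dE'; lia.
have d2 : (t.+2 < d)%N by rewrite dE'; lia.
split=> [|n|n|h1 h2 k]; rewrite ?bp' //; last first.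
  by move=> H; have [->|->] : k = t.+1 \/ k = t.+2 by lia.
split=> [||n].
- split=> [|n]; first by rewrite b0'.
  rewrite out ?ltnSn ?orbT // lo1 mul1r !big_cons big_nil /bond /= !nE.
  by rewrite !mulr1 mul1r expr1 oE1 negbK.
- split=> [|n]; first by rewrite b0'.
  rewrite out //; last by lia.
  by rewrite lo2 mul1r !big_cons big_nil /bond /= !nE !mulr1 !mul1r expr1 oE2 negbK.
by rewrite !big_cons big_nil /bond /= !nE !expr1 !mulr1.
Qed.

(** The hypothesis on free ends drops two mirror images among the nine pairs of ends. A fork facing
    a reflection remains in both orders, one of which is reversed. *)
Lemma linrec_ends : (r = Free -> l = Free) -> forall k, (k < d)%N -> linrec (b k).
Proof.
move=> rl; have Hs := ends_strip; have Hp := ends_gt0.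
have done_ : (forall k, (k < c)%N -> linrec (b k)) -> (forall k, (k <= m)%N -> linrec (f k)) ->
    (forall k, (t < k < d)%N -> linrec (b k)) -> forall k, (k < d)%N -> linrec (b k).
  move=> h1 h2 h3 k lt; case: (ltnP k c) => [|le]; first exact: h1.
  case: (leqP k t) => [le'|lt']; last by apply: h3; rewrite lt' lt.
  by have -> : b k = f (k - c)%N by [rewrite /f subnKC]; apply: h2; lia.
have [h hE] : exists h : nat -> nat, forall e, e \in chain c m ++ left_bonds l ++ right_bonds t r ->
    if o e.1.1 e.1.2 then (h e.1.1 < h e.1.2)%N else (h e.1.2 < h e.1.1)%N.
  by case: Hb => _ _ _ _ [h hE]; exists h => e; rewrite -(perm_mem HE); apply: hE.
have [[rE Hr]|[[q1 [q2 [z1 [z2 [Hr pz1 pz2 lz]]]]]|[dt Hr or]]] := right_end;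
have [[lE Hl]|[[o1 [o2 [x1 [x2 [lF Hl px1 px2 lx]]]]]|[c1 Hl ol]]] := left_end.
- apply: done_ => [k||k].
  + by rewrite lE.
  + exact: linrec_free_free Hs Hp Hl Hr.
  by rewrite dE rE /=; lia.
- by case: lF; exact: rl.
- by move: c1; rewrite (rl rE).
- have [H1 H2 H3] := linrec_free_fork _ _ _ _ _ Hs Hp _ _ _ _ Hl Hr pz1 pz2.
  by apply: done_ => // [k|]; [rewrite lE|exact: lz].
- have [H1 H2 H3 H4 H5] := linrec_strip_fork_fork _ _ _ _ _ _ _ _ _ _ _ _ _ Hs Hp Hl px1 px2 Hr pz1 pz2.
  by apply: done_ => //; [exact: lx|exact: lz].
- have Hr' : fork (f (m - 0)) rv q1 q2 z1 z2 by rewrite subn0.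
  have Hl' : refl_end (f (m - m)) lv (o 1%N 0%N) (b 0%N) by rewrite subnn.
  have [|H1 H2 H3 H4] := linrec_fork_refl _ _ _ _ _ (strip_rev _ _ _ _ _ Hs) _ _ _ Hl' _ _ _ _ Hr' pz1 pz2.
    by move=> k n le; apply: Hp; lia.
  apply: done_ => [k|k le|].
  + by rewrite c1; case: k.
  + by have := H1 (m - k)%N (leq_subr _ _); rewrite subKn.
  exact: lz.
- have [H1 H2] := linrec_free_refl _ _ _ _ _ Hs Hp _ _ Hr Hl.
  apply: done_ => // k; first by rewrite lE.
  by move: dE; rewrite dt /= => dE' H; have -> : k = t.+1 by lia.
- have [H1 H2 H3 H4] := linrec_fork_refl _ _ _ _ _ Hs Hp _ _ Hr _ _ _ _ Hl px1 px2.
  apply: done_ => // k; first exact: lx.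
  by move: dE; rewrite dt /= => dE' H; have -> : k = t.+1 by lia.
have [|||H1 H2 H3] := linrec_refl_refl _ _ _ _ _ _ _ _ _ (fun k => h (c + k)%N) (h t.+1) (h 0%N) Hs Hp Hr Hl.
- move=> k lt; have := hE (sbond (c + k) (c + k).+1); rewrite /= addnS; apply.
  by rewrite mem_cat; apply/orP; left; apply/mapP; exists (c + k)%N => //; rewrite mem_iota; lia.
- have := hE (t, t.+1, dbl true); apply.
  by rewrite !mem_cat dt inE eqxx !orbT.
- have m0 : (0%N, 1%N, dbl false) \in chain c m ++ left_bonds l ++ right_bonds t r.
    by rewrite !mem_cat c1 inE eqxx !orbT.
  by move: (hE _ m0); rewrite ol addn0 c1 /=; case: (o 0%N 1%N).
apply: done_ => // k; first by rewrite c1; case: k.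
by move: dE; rewrite dt /= => dE' H; have -> : k = t.+1 by lia.
Qed.
End ChainEnds.

Lemma chainS c len : chain c len.+1 = rcons (chain c len) (sbond (c + len) (c + len).+1).
Proof. by rewrite /chain -addn1 iotaD map_cat /= cats1. Qed.

Lemma good_chain d c len : (c + len < d)%N -> good_bonds d (chain c len).
Proof.
move=> lt; apply/allP => e /mapP[k]; rewrite mem_iota => H ->.
by apply/and5P; split=> //=; lia.
Qed.

Lemma good_dbl p : (dbl p).1 < 0 /\ (dbl p).2 < 0.
Proof. by case: p. Qed.

Lemma good_ends d m l r E : d = (end_size l + m + end_size r).+1 ->
  perm_eq E (chain (end_size l) m ++ left_bonds l ++ right_bonds (end_size l + m) r) ->
  good_bonds d E.
Proof.
move=> dE HE; rewrite /good_bonds (perm_all _ HE) !all_cat.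
have lt : (end_size l + m < d)%N by lia.
have := good_chain _ _ _ lt; rewrite /good_bonds => -> /= {lt}.
apply/andP; split.
  case: l dE {HE} => [|p|] /= dE //; last by rewrite !andbT; lia.
  by have [-> ->] := good_dbl p; rewrite !andbT; lia.
move: (end_size l + m)%N dE => t; case: r {HE} => [|p|] /= dE //; last by rewrite !andbT; lia.
by have [-> ->] := good_dbl p; rewrite !andbT; lia.
Qed.

Lemma linrec_affCycle m o b : (0 < m)%N ->
  bond_frise m.+1 (rcons (chain 0 m) (sbond m 0)) o b ->
  forall k, (k < m.+1)%N -> linrec (b k).
Proof.
move=> m0 [bp b0 os be [h hE]].
have chainin k : (k < m)%N -> sbond k k.+1 \in rcons (chain 0 m) (sbond m 0).
  by move=> lt; rewrite mem_rcons inE; apply/orP; right; apply/mapP; exists k; rewrite ?mem_iota.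
have lastin : sbond m 0 \in rcons (chain 0 m) (sbond m 0) by rewrite mem_rcons inE eqxx.
pose eps k := if (k < m)%N then o k k.+1 else o m 0%N.
pose lv n := b m (n + eps m)%N; pose rv n := b 0%N (n + ~~ eps m)%N.
have epsm : eps m = o m 0%N by rewrite /eps ltnn.
have epsk k : (k < m)%N -> eps k = o k k.+1 by rewrite /eps => ->.
have om : o 0%N m = ~~ o m 0%N by apply: (os _ lastin).
have S : strip m eps b lv rv.
  split=> [k le|k n le]; first exact: b0.
  rewrite be // -cats1 big_cat /= big_seq1 chain_prod add0n /bond /= !expr1; congr (1 + _).
  case: k le => [|k] le /=.
    have -> : (m == 0)%N = false by lia.
    rewrite m0 /lv epsm epsk //.
    by rewrite !mul1r (os _ (chainin 0%N m0)) mulrC.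
  rewrite le epsk // mulr1; case: (ltnP k.+1 m) => lt.
    rewrite gtn_eqF // mulr1 epsk //.
    by rewrite (os _ (chainin k.+1 lt)).
  have -> : (m == k.+1) by lia.
  by rewrite mulr1 /rv epsm om.
apply: (linrec_cycle _ _ _ _ _ h S) => // [k lt|].
  by rewrite epsk //; apply: (hE _ (chainin k lt)).
by rewrite epsm; apply: (hE _ lastin).
Qed.

(** A cycle of length 2: each vertex is both the left and the right neighbour of the other, whence
    the squares. *)
Lemma linrec_affA11 o b : bond_frise 2 [:: (0%N, 1%N, (-2, -2))] o b ->
  forall k, (k < 2)%N -> linrec (b k).
Proof.
move=> [bp b0 os be [h hE]].
have m0 : (0%N, 1%N, (-2, -2)) \in [:: (0%N, 1%N, (-2, -2) : int * int)] by rewrite inE.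
have o10 : o 1%N 0%N = ~~ o 0%N 1%N := os _ m0.
pose eps k := if k is 0 then o 0%N 1%N else ~~ o 0%N 1%N.
have S : strip 1 eps b (fun n => b 1%N (n + eps 1%N)%N) (fun n => b 0%N (n + ~~ eps 1%N)%N).
  split=> [k le|[|[|k]] n le] //; first exact: b0.
    by rewrite be // big_seq1 /bond /= mulr1 expr2 o10.
  by rewrite be // big_seq1 /bond /= mul1r expr2 negbK.
apply: (linrec_cycle _ _ _ _ _ h S) => // [[|k] lt //|].
  exact: (hE _ m0).
by have := hE _ m0; rewrite /=; case: (o 0%N 1%N).
Qed.

(** The diagram with a centre and four arms, folded: a chain of one vertex with a fork at each end
    and all arms equal, whence the fourth power. *)
Lemma linrec_affA22 o b : bond_frise 2 [:: (0%N, 1%N, (-4, -1))] o b ->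
  forall k, (k < 2)%N -> linrec (b k).
Proof.
move=> [bp b0 os be _].
have o10 : o 1%N 0%N = ~~ o 0%N 1%N by apply: (os (0%N, 1%N, (-4, -1))); rewrite inE.
pose lv n := b 0%N (n + o 0%N 1%N)%N * b 0%N (n + o 0%N 1%N)%N.
have S : strip 0 (fun=> true) (fun=> b 1%N) lv lv.
  split=> [k le|k n le] //; first exact: b0.
  have -> : k = 0%N by lia.
  by rewrite be // big_seq1 /bond /= mul1r (exprD _ 2 2) !expr2.
have A : arm (b 1%N) (o 0%N 1%N) (b 0%N).
  by split=> [|n]; [exact: b0|rewrite be // big_seq1 /bond /= mulr1 expr1 o10].
have F : fork (b 1%N) lv (o 0%N 1%N) (o 0%N 1%N) (b 0%N) (b 0%N) by split.
have p0 n : 0 < b 0%N n by apply: bp.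
have [|H1 H2 _ _ _] := linrec_strip_fork_fork _ _ _ _ _ _ _ _ _ _ _ _ _ S _ F p0 p0 F p0 p0.
  by move=> k n _; apply: bp.
by case=> [|[|k]] lt //; apply: (H1 0%N).
Qed.

Lemma bond_frise_unique d E o b (b' : nat -> nat -> rat) : bond_frise d E o b -> good_bonds d E ->
  (forall j, (j < d)%N -> b' j 0%N = 1) ->
  (forall j n, (j < d)%N -> b' j n * b' j n.+1 = 1 + \prod_(e <- E) bond b' o j n e) ->
  forall n j, (j < d)%N -> b j n = b' j n.
Proof.
move=> [bp b0 os be [h hE]] gE b0' be'; elim=> [|n IHn] j; first by move=> lt; rewrite b0 ?b0'.
have [t] := ubnP (h j); elim: t j => // t IHt j lt ltj.
have nz : b j n != 0 by rewrite gt_eqF ?bp.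
apply: (mulfI nz); rewrite be // (IHn j) // be'//; congr (1 + _); apply: eq_big_seq => e eE.
have /and5P[_ l1 l2 _ _] := allP gE _ eE; have := hE _ eE; have := os _ eE.
have step i (u : bool) : (i < d)%N -> (u -> (h i < h j)%N) -> b i (n + u)%N = b' i (n + u)%N.
  move=> li; case: u => Hi; last by rewrite addn0 IHn.
  by rewrite addn1 IHt //; have := Hi isT; lia.
rewrite /bond => -> hh; congr (_ * _); case: eqP => // Ej; congr (_ ^+ _); apply: step => //;
  by move: hh; rewrite Ej; case: (o _ _).
Qed.

(** * Tables for the exceptional Dynkin types *)

Definition oneN : BinNums.N := BinNums.Npos BinNums.xH.

Definition entry (tb : seq (seq BinNums.N)) (n j : nat) : BinNums.N := nth BinNums.N0 (nth [::] tb n) j.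

(** The counterpart of [bond] in binary arithmetic, fast enough to run over all orientations; [u] is
    the orientation bit of the bond. *)
Definition bondN (T : nat -> nat -> BinNums.N) (j n : nat) (eu : nat * nat * (nat * nat) * bool) : BinNums.N :=
  let: (i1, i2, (p1, p2), u) := eu in
  BinNat.N.mul (if i1 == j then iter p2 (BinNat.N.mul (T (n + ~~ u)%N i2)) oneN else oneN)
        (if i2 == j then iter p1 (BinNat.N.mul (T (n + u)%N i1)) oneN else oneN).

Definition rhsN T j n EU : BinNums.N := BinNat.N.add oneN (foldr (fun eu => BinNat.N.mul (bondN T j n eu)) oneN EU).

(* Sweeping d times propagates the new values along all arrows. The divisions need not be exact:
   the resulting table is verified by [check_table]. *)
Definition next_row d EU (cur : seq BinNums.N) : seq BinNums.N :=
  iter d (fun new => [seq BinNat.N.div (rhsN (entry [:: cur; new]) j 0 EU) (nth BinNums.N0 cur j) | j <- iota 0 d]) cur.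

Definition table d p EU : seq (seq BinNums.N) := traject (next_row d EU) (nseq d oneN) p.+1.

Definition check_table d p EU : bool :=
  let tb := table d p EU in
  all (fun n => all (fun j =>
    BinNat.N.eqb (BinNat.N.mul (entry tb n j) (entry tb n.+1 j)) (rhsN (entry tb) j n EU)) (iota 0 d)) (iota 0 p)
  && all (fun j => BinNat.N.eqb (entry tb 0 j) oneN && BinNat.N.eqb (entry tb p j) oneN) (iota 0 d).

Fixpoint all_bits n : seq (seq bool) :=
  if n is n'.+1 then [seq true :: s | s <- all_bits n'] ++ [seq false :: s | s <- all_bits n'] else [:: [::]].

Lemma mem_all_bits s : s \in all_bits (size s).
Proof.
elim: s => [|[] s IH] //=; rewrite mem_cat; apply/orP; [left|right]; exact: map_f.
Qed.

Definition exponents (E : seq (nat * nat * (int * int))) : seq (nat * nat * (nat * nat)) :=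
  [seq (e.1, (`|e.2.1|%N, `|e.2.2|%N)) | e <- E].

Definition check_all d p E : bool :=
  all (fun s => check_table d p (zip (exponents E) s)) (all_bits (size E)).

Lemma linrec_table d p E o b : bond_frise d E o b -> good_bonds d E -> (0 < p)%N ->
  check_all d p E -> forall k, (k < d)%N -> linrec (b k).
Proof.
move=> Hb gE p0 chk.
pose EU := zip (exponents E) [seq o e.1.1 e.1.2 | e <- E].
have : check_table d p EU.
  by apply: (allP chk); have := mem_all_bits [seq o e.1.1 e.1.2 | e <- E]; rewrite size_map.
rewrite /check_table; set T := entry _ => /andP[/allP chk1 /allP chk2].
pose b' j n : rat := (BinNat.N.to_nat (T (n %% p)%N j))%:R.
have os : forall e, e \in E -> o e.1.2 e.1.1 = ~~ o e.1.1 e.1.2 by case: Hb.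
have T01 j : (j < d)%N -> T 0%N j = oneN /\ T p j = oneN.
  by move=> lt; have := chk2 j; rewrite mem_iota lt => /(_ isT)/andP[/BinNat.N.eqb_eq -> /BinNat.N.eqb_eq ->].
(* One step past the last residue reads row [p] of the table, which again consists of ones. *)
have shift j n (u : bool) : (j < d)%N -> b' j (n + u)%N = (BinNat.N.to_nat (T (n %% p + u)%N j))%:R.
  move=> lt; case: u; last by rewrite !addn0.
  rewrite /b' -modnDml; have := ltn_pmod n p0; rewrite leq_eqVlt => /orP[/eqP E'|lt'].
    by rewrite addn1 E' modnn; have [-> ->] := T01 j lt.
  by rewrite modn_small // addn1.
have powE c (x : BinNums.N) : (BinNat.N.to_nat (iter c (BinNat.N.mul x) oneN))%:R = (BinNat.N.to_nat x)%:R ^+ c :> rat.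
  by elim: c => [|c IH]; rewrite ?expr0 // iterS Nnat.N2Nat.inj_mul natrM IH exprS.
have bE : forall n j, (j < d)%N -> b j n = b' j n.
  apply: (bond_frise_unique _ _ _ _ _ Hb gE) => [j lt|j n lt].
    by rewrite /b' mod0n; have [-> _] := T01 j lt.
  have := shift j n true lt; rewrite addn1 => ->; have := shift j n false lt; rewrite addn0 => ->.
  rewrite addn0 -natrM -multE -Nnat.N2Nat.inj_mul addn1.
  have := chk1 (n %% p)%N; rewrite mem_iota ltn_pmod // => /(_ isT)/allP/(_ j).
  rewrite mem_iota lt => /(_ isT)/BinNat.N.eqb_eq ->.
  rewrite /rhsN Nnat.N2Nat.inj_add plusE natrD; congr (1 + _).
  have gb : forall e, e \in E -> (e.1.1 < d)%N /\ (e.1.2 < d)%N.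
    by move=> e /(allP gE)/and5P[_ ? ? _ _].
  rewrite /EU /exponents.
  elim: (E) gb os => [|e E' IH] gb os; first by rewrite big_nil.
  have [l1 l2] := gb e (mem_head _ _); have oe := os e (mem_head _ _).
  rewrite big_cons /= Nnat.N2Nat.inj_mul multE natrM; congr (_ * _); last first.
    by apply: IH => e' he; [apply: gb|apply: os]; rewrite inE he orbT.
  rewrite /bondN /bond; case: e l1 l2 oe {gb os} => [[i1 i2] [p1 p2]] /= l1 l2 oe.
  rewrite oe !shift // Nnat.N2Nat.inj_mul multE natrM -!powE.
  by congr (_ * _); case: ifP.
move=> k lt; apply: (linrec_periodic p) => // n; rewrite !bE // /b' ?modnDr //.
Qed.

(** * Conclusion, type by type *)

Section Types.
Variables (d : nat) (C : 'M[int]_d) (o : rel 'I_d) (a : 'I_d -> nat -> rat).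
Hypotheses (Co : acyclic_orientation C o) (Fa : is_frise C o a).

Lemma N_rational_of_bonds E : cartan_of_type C (gcm E) -> good_bonds d E ->
  (forall o' b, bond_frise d E o' b -> forall k, (k < d)%N -> linrec (b k)) ->
  forall j, N_rational (a j).
Proof.
move=> CE gE H; have [o' [b [Hb Hj]]] := frise_bonds _ _ _ _ _ Co Fa CE gE.
exact/Hj/(H _ _ Hb).
Qed.

Lemma N_rational_ends m l r E : cartan_of_type C (gcm E) ->
  d = (end_size l + m + end_size r).+1 ->
  perm_eq E (chain (end_size l) m ++ left_bonds l ++ right_bonds (end_size l + m) r) ->
  (r = Free -> l = Free) -> forall j, N_rational (a j).
Proof.
move=> CE dE HE rl; apply: (N_rational_of_bonds _ CE (good_ends _ _ _ _ _ dE HE)) => o' b Hb.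
exact: linrec_ends Hb dE HE rl.
Qed.

Lemma N_rational_table p E : cartan_of_type C (gcm E) -> good_bonds d E ->
  (0 < p)%N -> check_all d p E -> forall j, N_rational (a j).
Proof.
move=> CE gE p0 chk; apply: (N_rational_of_bonds _ CE gE) => o' b Hb.
exact: linrec_table Hb gE p0 chk.
Qed.

Lemma N_rational_dynkin : dynkin_type C -> forall j, N_rational (a j).
Proof.
case=> [[d1 CE]|[[d2 [p CE]]|[[d4 CE]|[[dE CE]|[[dE CE]|[dE CE]]]]]].
- by apply: (N_rational_ends d.-1 Free Free _ CE) => //=; [lia|rewrite cats0].
- by apply: (N_rational_ends (d - 2) Free (Double p) _ CE) => //=; [lia|
    rewrite -cats1; have -> : d.-1 = (d - 2).+1 by lia].
- apply: (N_rational_ends (d - 3) Free Fork _ CE) => //=; first by lia.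
  have -> : d.-1 = (d - 3).+2 by lia.
  by have -> : (d - 2 = (d - 3).+1)%N by [lia]; rewrite chainS add0n -!cats1 -catA.
- move: dE; rewrite !inE => /or3P[] /eqP dE; move: CE; rewrite /typeE.
  (* With [h] the Coxeter number, the period is [h + 2 = 14] for [E_6], whose Weyl group does not
     contain -1, and [(h + 2) / 2] for the others: 10, 16, 7 and 4 for [E_7], [E_8], [F_4] and
     [G_2]. *)
  + by move=> CE; apply: (N_rational_table 14 _ CE); rewrite ?dE; vm_compute.
  + by move=> CE; apply: (N_rational_table 10 _ CE); rewrite ?dE; vm_compute.
  by move=> CE; apply: (N_rational_table 16 _ CE); rewrite ?dE; vm_compute.
- by apply: (N_rational_table 7 _ CE); rewrite ?dE; vm_compute.
by apply: (N_rational_table 4 _ CE); rewrite ?dE; vm_compute.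
Qed.

Lemma N_rational_euclidean : euclidean_series_type C -> forall j, N_rational (a j).
Proof.
case=> [[dE [CE|CE]]|[[d3 CE]|[[d3 [p [q CE]]]|[[d4 [q CE]]|[d5 CE]]]]].
- apply: N_rational_of_bonds CE _ _; rewrite dE //; exact: linrec_affA11.
- apply: N_rational_of_bonds CE _ _; rewrite dE //; exact: linrec_affA22.
- have dE : d = d.-1.+1 by lia.
  apply: N_rational_of_bonds CE _ _.
    rewrite /good_bonds all_rcons.
    have lt : (0 + d.-1 < d)%N by lia.
    by have := good_chain _ _ _ lt; rewrite /good_bonds => ->; rewrite andbT; apply/and5P; split=> //=; lia.
  by move=> o' b; have := linrec_affCycle d.-1 o' b; rewrite -dE; apply; lia.
- apply: (N_rational_ends (d - 3) (Double p) (Double q) _ CE) => //=; first by lia.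
  have -> : (d - 2 = 1 + (d - 3))%N by lia.
  have -> : (d.-1 = (1 + (d - 3)).+1)%N by lia.
  by rewrite -cats1; apply/permPl/(perm_catCA [:: _]).
- apply: (N_rational_ends (d - 4) Fork (Double q) _ CE) => //=; first by lia.
  have -> : (d - 2 = 2 + (d - 4))%N by lia.
  have -> : (d.-1 = (2 + (d - 4)).+1)%N by lia.
  have -> : (d - 3 = (d - 4).+1)%N by lia.
  by rewrite -cats1; apply/permPl/(perm_catCA [:: _; _]).
apply: (N_rational_ends (d - 5) Fork Fork _ CE) => //=; first by lia.
have -> : (d.-1 = (2 + (d - 5)).+2)%N by lia.
have -> : (d - 3 = 2 + (d - 5))%N by lia.
rewrite chainS; have -> : chain 1 (2 + (d - 5)).-1 = sbond 1 2 :: chain 2 (d - 5) by [].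
by rewrite -!cats1 -catA; apply/permPl/(perm_catCA [:: _; _]).
Qed.

End Types.

Theorem theorem2 (d : nat) (C : 'M[int]_d) (o : rel 'I_d)
    (a : 'I_d -> nat -> rat) :
  is_cartan C -> cartan_connected C ->
  dynkin_type C \/ euclidean_series_type C ->
  acyclic_orientation C o ->
  is_frise C o a ->
  forall j : 'I_d, N_rational (a j).
Proof.
move=> _ _ [Cd|Ce] Co Fa; first exact: N_rational_dynkin Co Fa Cd.
exact: N_rational_euclidean Co Fa Ce.
Qed.
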